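(* Let $\mu$ be a strong limit singular cardinal of cofinality $\aleph_0$, let $\lambda=2^\mu$, let $\kappa\le\lambda$ be a cardinal, and let $T$ be a tree with a root, with $\kappa$ levels and at most $\lambda$ nodes, whose number of $\kappa$-branches is $\chi>\lambda$. Then there is a superatomic Boolean algebra ${\mathbb B}$ such that $|{\mathbb B}|=\chi$ and \[|{\rm Atom}({\mathbb B})|=|T|+\mu\le|{\rm Aut}({\mathbb B})|\le\lambda.\]
   Context: ${\rm Atom}({\mathbb B})$ is the set of atoms of ${\mathbb B}$ and ${\rm Aut}({\mathbb B})$ its set of automorphisms. A $\kappa$-branch of a tree with $\kappa$ levels is a linearly ordered, downward closed subset meeting every level. *)

(* Defs.v *)
(* MathComp + mathcomp-classical (classical sets and cardinality). *)
From HB Require Import structures.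
From mathcomp Require Import all_boot all_order.
From mathcomp Require Export boolp classical_sets functions cardinality wochoice.

Set Implicit Arguments.
Unset Strict Implicit.
Unset Printing Implicit Defensive.

Import Order.Theory.

Local Open Scope classical_set_scope.
Local Open Scope order_scope.
Local Open Scope card_scope.

(** * Cardinals

A cardinal is represented by an initial ordinal, that is, by a well-ordered
type all of whose proper initial segments have strictly smaller cardinality.
Sizes of other objects are compared with [#<=] and [#=]. *)

Definition card_lt (T U : Type) (A : set T) (B : set U) : bool :=
  (A #<= B) && (A #!= B).

Definition initial_segment (d : Order.disp_t) (T : porderType d) (a : T) :
  set T := [set b | b < a].

Definition cardinal (d : Order.disp_t) (M : orderType d) : Prop :=
  well_order (<=%O : rel M) /\
  forall a : M, card_lt (initial_segment a) [set: M].

Definition strong_limit (d : Order.disp_t) (M : orderType d) : Prop :=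
  forall N : Type, card_lt [set: N] [set: M] -> card_lt [set: set N] [set: M].

Definition cofinal (d : Order.disp_t) (M : orderType d) (C : set M) : Prop :=
  forall x, exists2 y, C y & x <= y.

(* The cofinality of [M] is the cardinality of [A]. *)
Definition has_cofinality (d : Order.disp_t) (M : orderType d)
    (U : Type) (A : set U) : Prop :=
  (exists2 C : set M, cofinal C & C #= A) /\
  (forall C : set M, cofinal C -> A #<= C).

Definition singular (d : Order.disp_t) (M : orderType d) : Prop :=
  infinite_set [set: M] /\
  exists2 A : set M, has_cofinality M A & card_lt A [set: M].

(** * Trees *)

Definition tree (d : Order.disp_t) (T : porderType d) : Prop :=
  forall x : T, wo_chain (<=%O : rel T) [pred y : T | y < x].

Definition rooted (d : Order.disp_t) (T : porderType d) : Prop :=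
  exists r : T, forall x, r <= x.

(* The set of predecessors of [x] has the order type of the ordinal [a],
   identified with the initial segment that it determines in [K]. *)
Definition at_level (d d' : Order.disp_t) (T : porderType d)
    (K : orderType d') (x : T) (a : K) : Prop :=
  exists2 f : T -> K,
    set_bij (initial_segment x) (initial_segment a) f &
    {in initial_segment x &, {mono f : y z / y <= z}}.

(* The set of levels of nodes of [T] is exactly [K]. *)
Definition has_levels (d d' : Order.disp_t) (T : porderType d)
    (K : orderType d') : Prop :=
  (forall x : T, exists a : K, at_level x a) /\
  (forall a : K, exists x : T, at_level x a).

Definition branches (d d' : Order.disp_t) (T : porderType d)
    (K : orderType d') : set (set T) :=
  [set b : set T |
    [/\ forall x y, b x -> b y -> x >=< y,
        forall x y, b y -> x <= y -> b x &
        forall a : K, exists2 x, b x & at_level x a]].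

(** * Boolean algebras

Boolean algebras are the complemented distributive lattices
[ctbDistrLatticeType].  The library's [{tblmorphism _ -> _}] only asks for the
preservation of [\bot] and [\top], hence the explicit notion below. *)

Definition boolean_hom (d d' : Order.disp_t) (B : ctbDistrLatticeType d)
    (C : ctbDistrLatticeType d') (f : B -> C) : Prop :=
  [/\ {morph f : x y / x `&` y}, {morph f : x y / x `|` y},
      {morph f : x / ~` x}, f \bot = \bot & f \top = \top].

Definition atoms (d : Order.disp_t) (B : ctbDistrLatticeType d) : set B :=
  [set a | a != \bot /\ forall b : B, b <= a -> b = \bot \/ b = a].

Definition atomic (d : Order.disp_t) (B : ctbDistrLatticeType d) : Prop :=
  forall b : B, b != \bot -> exists2 a, atoms a & a <= b.

(* Every homomorphic image is atomic. *)
Definition superatomic (d : Order.disp_t) (B : ctbDistrLatticeType d) : Prop :=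
  forall (d' : Order.disp_t) (C : ctbDistrLatticeType d')
    (f : B -> C),
    boolean_hom f -> (forall c, exists b, f b = c) -> atomic C.

Definition automorphisms (d : Order.disp_t) (B : ctbDistrLatticeType d) :
  set (B -> B) :=
  [set f | boolean_hom f /\ bijective f].

Arguments branches {d d'} T K.
Arguments atoms {d} B.
Arguments automorphisms {d} B.

(* Main.v *)
(* The algebra lives on the points [T + M] and is generated by the singletons,
the branches, the initial segments [{y | y < x}] of the tree and a family [P] of
almost disjoint subsets of [T] none of which is split into two infinite pieces
by a branch or an initial segment.  Ordering these generators by type and, among
initial segments, by the tree, every generator is split trivially by every other
one, modulo finitely many smaller ones, hence superatomicity.  Singletons are
the only atoms and transpositions of points are automorphisms.

An automorphism is a permutation of the points.  Its restriction to the points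
it moves can be coded by a subset of [M] as soon as it moves at most [#|M|]
points, so [P] has to prevent automorphisms from moving more.  Embed [T] into
the subsets of [M], seen as branches of the tree of their traces on initial
segments, which has [#|M|] nodes and cofinality omega.  If [f] moves a set [D]
of more than [#|M|] nodes of [T] off itself, then some [D0] in [D] of size
[#|M|] accumulates to [2 ^ #|M|] branches (a Cantor-Bendixson argument, which
uses that [M] is a strong limit of cofinality omega).  There are only
[2 ^ #|M|] pairs [(D0, f|D0)], so a recursion of that length can choose
for each of them a set [P i] in [D0] converging to a new branch, and such that
[f @` P i] splits off an infinite part of a set that no generator splits;
hence [f @` P i] is not in the algebra. *)

From HB Require Import structures.
Require Import Defs.
From mathcomp Require Import all_boot all_order.
(* Again after [all_boot], so that set lemmas mean classical sets, not [{set T}]. *)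
From mathcomp Require Import boolp classical_sets functions cardinality wochoice.
Set Implicit Arguments.
Unset Strict Implicit.
Unset Printing Implicit Defensive.
Import Order.Theory.
Local Open Scope classical_set_scope.
Local Open Scope card_scope.

(** * Cardinal arithmetic *)

Lemma card_le_inj T U (A : set T) (B : set U) (f : T -> U) :
  (forall x, A x -> B (f x)) ->
  (forall x y, A x -> A y -> f x = f y -> x = y) -> A #<= B.
Proof.
move=> AB fI; have [g] : $|{injfun A >-> B}|.
  by apply/injfunPex; exists f => // x y /set_mem Ax /set_mem Ay; apply: fI.
exact: inj_card_le g.
Qed.

Lemma card_leT_inj T U (f : T -> U) : injective f -> [set: T] #<= [set: U].
Proof. by move=> fI; apply: (@card_le_inj _ _ _ _ f) => // x y _ _ /fI. Qed.

Lemma card_le_injE T U (u : U) (A : set T) (B : set U) : A #<= B ->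
  exists f : T -> U, (forall x, A x -> B (f x)) /\
    (forall x y, A x -> A y -> f x = f y -> x = y).
Proof.
elim/Ppointed: U => U in u B *; first by case: (no u).
move=> /pcard_leP[f]; exists f; split=> [x Ax|x y Ax Ay].
  exact: funS.
by move=> fxy; apply: (inj _ _ fxy); apply: mem_set.
Qed.

Lemma card_leT_injE T U : [set: T] #<= [set: U] ->
  exists f : T -> U, injective f.
Proof.
move=> TU; have [[u]|nU] := pselect (inhabited U).
  have [f [_ fI]] := card_le_injE u TU.
  by exists f => x y; apply: fI.
move: TU => /card_leP[f].
have F (x : T) : False by case: nU; exact: (inhabits (val (f (to_setT x)))).
by exists (fun x => False_rect U (F x)) => x.
Qed.

(** * Well-founded recursion, well orders and comparability *)

Lemma wf_choice I A (lt : I -> I -> Prop) (P : I -> (I -> A) -> A -> Prop) :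
  A -> well_founded lt ->
  (forall i F G a, (forall j, lt j i -> F j = G j) -> P i F a -> P i G a) ->
  (forall i F, exists a, P i F a) -> exists F, forall i, P i F (F i).
Proof.
move=> a0 wf ext ex.
pose ex0 i F := cid (ex i F).
(* Values outside the predecessors of [i] are replaced by [a0]; by [ext] the requirement at [i] does
   not see the difference. *)
pose rec i (r : forall j, lt j i -> A) : I -> A := fun j =>
  if pselect (lt j i) is left h then r j h else a0.
pose step i r := projT1 (ex0 i (rec i r)).
pose F := Fix wf (fun=> A) step.
have FE i : F i = step i (fun j _ => F j).
  rewrite /F Fix_eq // => x f g fg; rewrite /step; congr (projT1 (ex0 _ _)).
  by apply/funext => j; rewrite /rec; case: pselect.
exists F => i; rewrite FE /step; case: (ex0 i _) => a /=.
by apply: ext => j ji; rewrite /rec; case: pselect.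
Qed.

Lemma wf_min T (lt : T -> T -> Prop) (P : T -> Prop) : well_founded lt ->
  (exists x, P x) -> exists2 x, P x & forall y, lt y x -> ~ P y.
Proof.
move=> wf [x]; elim/(well_founded_ind wf): x => x IH Px.
have [[y yx Py]|nex] := pselect (exists2 y, lt y x & P y); first exact: IH Py.
by exists x => // y yx Py; apply: nex; exists y.
Qed.

Definition strict_well_order T (lt : T -> T -> Prop) : Prop :=
  [/\ well_founded lt, forall x y z, lt x y -> lt y z -> lt x z &
      forall x y, [\/ lt x y, x = y | lt y x]].

Lemma min_wf T (lt : T -> T -> Prop) :
  (forall P : T -> Prop, (exists x, P x) ->
     exists2 x, P x & forall y, lt y x -> ~ P y) -> well_founded lt.
Proof.
move=> min x; apply: contrapT => nx.
have [|z nz zmin] := min (fun x => ~ Acc lt x); first by exists x.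
by apply: nz; constructor=> y /zmin/contrapT.
Qed.

Lemma well_order_wf (T : eqType) (R : rel T) :
  well_order R -> well_founded (fun x y => ~~ R y x).
Proof.
move=> wo; apply: min_wf => P [x Px].
have [|z [[/asboolP Pz lb] _]] := wo [pred x | `[< P x >]].
  by exists x; apply/asboolP.
exists z => // y /negP zy Py; apply: zy; apply: lb; exact/asboolP.
Qed.

Lemma strict_well_order_of (T : eqType) (R : rel T) :
  well_order R -> strict_well_order (fun x y => ~~ R y x).
Proof.
move=> wo; have chT : wo_chain R predT by move=> A _; apply: wo.
have tot x y : R x y || R y x by apply: (wo_chainW chT).
have anti x y : R x y -> R y x -> x = y.
  by move=> xy yx; apply: (wo_chain_antisymmetric chT) => //; rewrite xy yx.
split; first exact: well_order_wf.
- move=> x y z nyx nzy; apply/negP => zx.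
  (* The least of [x], [y], [z] contradicts the assumed cycle, whichever of the three it is. *)
  have [|w [[wA lb] _]] := wo [pred u | (u == x) || (u == y) || (u == z)].
    by exists x; rewrite inE eqxx.
  have [Rx Ry Rz] : [/\ R w x, R w y & R w z].
    by split; apply: lb; rewrite inE eqxx ?orbT.
  move: wA; rewrite inE => /orP[/orP[]|] /eqP wE; subst w.
  + have xz : x = z by exact: anti.
    by subst z; have := tot x y; rewrite (negPf nyx) (negPf nzy).
  + by rewrite Rx in nyx.
  + by rewrite Ry in nzy.
- move=> x y; case: (boolP (R y x)) => yx; last by constructor 1.
  case: (boolP (R x y)) => xy; last by constructor 3.
  by constructor 2; apply: anti.
Qed.

Lemma ex_strict_well_order T : exists lt : T -> T -> Prop, strict_well_order lt.
Proof.
have [R /strict_well_order_of] := @well_ordering_principle {classic T}.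
by eexists; eassumption.
Qed.

(** If some segment of a well order is as large as [T], take the least such [i] and pull the order
    back along an injection of [T] below [i]. This provides recursions of length [2 ^ #|M|] with
    fewer than [2 ^ #|M|] stages before each one. *)
Lemma ex_initial_well_order T : exists2 lt : T -> T -> Prop,
  strict_well_order lt & forall x, ~ ([set: T] #<= [set y | lt y x]).
Proof.
have [lt [wf tr tot]] := ex_strict_well_order T.
have [big|small] := pselect (exists x, [set: T] #<= [set y | lt y x]);
  last by exists lt => // x Tx; apply: small; exists x.
have [i Ti imin] := wf_min wf big.
have [f [fi fI]] := card_le_injE i Ti.
exists (fun x y => lt (f x) (f y)).
  split.
  - apply: min_wf => P [x Px].
    have [|_ [y Py <-] ymin] := @wf_min _ _ (fun u => exists2 x, P x & f x = u) wf.
      by exists (f x), x.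
    by exists y => // z zy Pz; apply: (ymin _ zy); exists z.
  - by move=> x y z; apply: tr.
  - move=> x y; case: (tot (f x) (f y)) => [xy|/fI xy|xy].
    + by constructor 1.
    + by constructor 2; apply: xy.
    + by constructor 3.
move=> x Tx; apply: (imin (f x)); first exact: fi.
apply: card_le_trans Tx _; apply: (@card_le_inj _ _ _ _ f) => // u v _ _.
exact: fI.
Qed.

Lemma card_le_total T U : [set: T] #<= [set: U] \/ [set: U] #<= [set: T].
Proof.
have [lt [wf tr tot]] := ex_strict_well_order T.
pose P i (F : T -> option U) (a : option U) :=
  if a is Some u then forall j, lt j i -> F j <> Some u
  else forall u, exists2 j, lt j i & F j = Some u.
have [|i F|F FP] := @wf_choice T (option U) lt P None wf.
- move=> i F G [u|] FG /=; first by move=> H j ji; rewrite -FG //; apply: H.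
  by move=> H u; have [j ji Fj] := H u; exists j => //; rewrite -FG.
- have [[u Hu]|H] := pselect (exists u, forall j, lt j i -> F j <> Some u).
    by exists (Some u).
  exists None => u; apply: contrapT => nH; apply: H; exists u => j ji Fj.
  by apply: nH; exists j.
have [[i Fi]|H] := pselect (exists i, F i = None).
  right; have := FP i; rewrite Fi /= => sur.
  have /choice[g gP] u : exists j, F j = Some u.
    by have [j _ ju] := sur u; exists j.
  by apply: (@card_leT_inj _ _ g) => u v guv; have := gP v; rewrite -guv gP => -[].
have /choice[g gP] i : exists u, F i = Some u.
  by case E: (F i) => [u|]; [exists u|case: H; exists i].
left; apply: (@card_leT_inj _ _ g) => i j gij.
case: (tot i j) => // [ij|ji].
  by have := FP j; rewrite gP => /(_ i ij); rewrite gP gij.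
by have := FP i; rewrite gP => /(_ j ji); rewrite gP gij.
Qed.

Lemma card_le_total_set T U (A : set T) (B : set U) : A #<= B \/ B #<= A.
Proof.
have := card_le_total A B.
by rewrite !(card_le_eql (card_setT _)) !(card_le_eqr (card_setT _)).
Qed.

Lemma card_leNge T U : ~ ([set: T] #<= [set: U]) -> [set: U] #<= [set: T].
Proof. by case: (card_le_total T U). Qed.

Lemma card_le_prod T T' U U' : [set: T] #<= [set: T'] -> [set: U] #<= [set: U'] ->
  [set: T * U] #<= [set: T' * U'].
Proof.
move=> /card_leT_injE[f fI] /card_leT_injE[g gI].
apply: (@card_leT_inj _ _ (fun x => (f x.1, g x.2))) => -[a b] [c d] /=.
by move=> [/fI-> /gI->].
Qed.

Lemma card_le_sum T T' U U' : [set: T] #<= [set: T'] -> [set: U] #<= [set: U'] ->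
  [set: T + U] #<= [set: T' + U'].
Proof.
move=> /card_leT_injE[f fI] /card_leT_injE[g gI].
apply: (@card_leT_inj _ _ (fun x => match x with inl a => inl (f a)
  | inr b => inr (g b) end)).
by move=> [a|b] [c|d] //= [] => [/fI->|/gI->].
Qed.

Lemma card_le_arrow I T U : [set: T] #<= [set: U] ->
  [set: I -> T] #<= [set: I -> U].
Proof.
move=> /card_leT_injE[f fI]; apply: (@card_leT_inj _ _ (fun g => f \o g)) => g h.
by move=> /funeqP gh; apply/funext => i; apply: fI; exact: gh.
Qed.

Lemma card_le_sets T U : [set: T] #<= [set: U] -> [set: set T] #<= [set: set U].
Proof.
move=> /card_leT_injE[f fI].
have K (A : set T) : f @^-1` (f @` A) = A.
  by apply/seteqP; split=> [x [y Ay /fI <-]|x Ax] //; exists x.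
by apply: (@card_leT_inj _ _ (fun A => f @` A)); apply: can_inj K.
Qed.

(** * Arithmetic of infinite cardinals *)

Lemma infinite_nat_inj T : infinite_set [set: T] ->
  exists f : nat -> T, injective f.
Proof. by move=> /infiniteP/card_leT_injE. Qed.

(* A maximal injection [D * D -> D] has [D] as large as [T]: otherwise the
   complement of [D] contains a copy [E] of [D], into which the three missing
   rectangles of [(D + E) * (D + E)] can be sent. *)
Lemma infinite_square T : infinite_set [set: T] -> [set: T * T] #<= [set: T].
Proof.
move=> /infinite_nat_inj[n nI].
pose S := (set T * (T -> T -> T))%type.
pose inj2 (D : set T) (F : T -> T -> T) :=
  (forall x y, D x -> D y -> D (F x y)) /\
  (forall x y u v, D x -> D y -> D u -> D v -> F x y = F u v -> x = u /\ y = v).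
(* [s.2] is total but only its values on [s.1] matter. Every domain contains [range n], which makes
   [n 0], [n 1], [n 2] available as tags. *)
pose ok : {pred {classic S}} :=
  fun s : {classic S} => `[< (range n `<=` s.1) /\ inj2 s.1 s.2 >].
pose R : rel {classic S} := fun s t =>
  `[< (s.1 `<=` t.1) /\ forall x y, s.1 x -> s.1 y -> s.2 x y = t.2 x y >].
have Rrefl : {in ok, reflexive R} by move=> s _; apply/asboolP; split.
have Rtr : {in ok & &, transitive R}.
  move=> t s u _ _ _ /asboolP[st stE] /asboolP[tu tuE]; apply/asboolP.
  by split=> [x /st/tu //|x y sx sy]; rewrite stE // tuE //; apply: st.
have [p [pI p0]] : exists p : nat -> nat -> nat,
    (forall a b c d, p a b = p c d -> a = c /\ b = d) /\ True.
  have /card_eqPle[/card_leT_injE[q qI] _] := card_nat2.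
  by exists (fun a b => q (a, b)); split=> // a b c d /qI[].
have [ni niK] : exists ni : T -> nat, cancel n ni.
  have /choice[g gP] x : exists k, (exists m, n m = x) -> n k = x.
    by have [[m <-]|nm] := pselect (exists m, n m = x); [exists m|exists 0%N].
  by exists g => m; apply: nI; apply: gP; exists m.
have [C Cok Cwo|[D F] /asboolP[/= nD [DF FI]] max] := Zorn's_lemma Rrefl Rtr.
  have [[s0 Cs0]|C0] := pselect (exists s, s \in C); last first.
    exists (range n, fun x y => n (p (ni x) (ni y))).
      apply/asboolP; split=> //=; split=> [x y _ _|]; first by eexists.
      by move=> _ _ _ _ [a _ <-] [b _ <-] [c _ <-] [d _ <-];
        rewrite !niK => /nI/pI[-> ->].
    by move=> s Cs; case: C0; exists s.
  have Cch := wo_chainW Cwo.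
  pose D : set T := fun x => exists2 s : {classic S}, s \in C & s.1 x.
  have D2 x y : D x -> D y -> exists s : {classic S}, [/\ s \in C, s.1 x & s.1 y].
    move=> [s Cs sx] [t Ct ty]; have /orP[] := Cch _ _ Cs Ct.
      by move=> /asboolP[st _]; exists t; split=> //; apply: st.
    by move=> /asboolP[ts _]; exists s; split=> //; apply: ts.
  have /choice[F FP] (xy : T * T) : exists z, forall s : {classic S}, s \in C ->
      s.1 xy.1 -> s.1 xy.2 -> z = s.2 xy.1 xy.2.
    have [[s [Cs sx sy]]|nxy] := pselect (exists s : {classic S},
        [/\ s \in C, s.1 xy.1 & s.1 xy.2]); last first.
      by exists (n 0%N) => s Cs sx sy; case: nxy; exists s.
    exists (s.2 xy.1 xy.2) => t Ct tx ty; have /orP[] := Cch _ _ Cs Ct.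
      by move=> /asboolP[_ ->].
    by move=> /asboolP[_ ->].
  exists (D, fun x y => F (x, y)); last first.
    move=> s Cs; apply/asboolP; split=> [x sx|x y sx sy] /=; first by exists s.
    by rewrite (FP (x, y) s).
  apply/asboolP; split=> /=.
    move=> x nx; exists s0 => //; have /asboolP[ns _] := Cok _ Cs0; exact: ns.
  split=> [x y Dx Dy|x y u v Dx Dy Du Dv].
    have [s [Cs sx sy]] := D2 x y Dx Dy; exists s => //.
    have /asboolP[_ [sD _]] := Cok _ Cs.
    by rewrite (FP (x, y) s) //; apply: sD.
  have [s [Cs sx sy]] := D2 x y Dx Dy; have [t [Ct tu tv]] := D2 u v Du Dv.
  rewrite (FP (x, y) s) // (FP (u, v) t) //=.
  have /asboolP[_ [_ sI]] := Cok _ Cs; have /asboolP[_ [_ tI]] := Cok _ Ct.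
  have /orP[] := Cch _ _ Cs Ct => /asboolP[st stE].
    by rewrite stE //; apply: tI => //; apply: st.
  by rewrite stE //; apply: sI => //; apply: st.
have Dn k : D (n k) by apply: nD; exists k.
have [/(card_le_injE (n 0%N))[g [gD gI]]|] := card_le_total_set D (~` D).
  have /choice[r rP] x : exists y, (D x -> y = x) /\ ((g @` D) x -> D y /\ g y = x).
    have [Dx|nDx] := pselect (D x).
      exists x; split=> // -[y Dy gy]; exfalso; apply: (gD y) => //.
      by rewrite gy.
    have [[y Dy gy]|ngx] := pselect ((g @` D) x); first by exists y.
    by exists x; split.
  have rD x : (D `|` g @` D) x -> D (r x).
    have [rD rg] := rP x; case=> [Dx|/rg[]//]; by rewrite rD.
  have rI x y : (D x <-> D y) -> (D `|` g @` D) x -> (D `|` g @` D) y ->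
      r x = r y -> x = y.
    have [rDx rgx] := rP x; have [rDy rgy] := rP y.
    move=> xy [Dx|gx] Dgy rxy.
      by move: rxy; rewrite rDx // rDy //; apply/xy.
    case: Dgy => [Dy|gy]; first by move: rxy; rewrite rDx ?rDy //; apply/xy.
    by have [_ <-] := rgx gx; have [_ <-] := rgy gy; rewrite rxy.
  pose tag x y := n (if `[< D x >] then 0%N else if `[< D y >] then 1%N else 2).
  pose F' x y := if `[< D x /\ D y >] then F x y
    else g (F (tag x y) (F (r x) (r y))).
  pose s : {classic S} := (D `|` g @` D, F').
  have sok : s \in ok.
    apply/asboolP; split=> /= [x nx|]; first by left; apply: nD.
    have DFr x y : (D `|` g @` D) x -> (D `|` g @` D) y ->
        D (F (tag x y) (F (r x) (r y))).
      by move=> sx sy; apply: (DF); [exact: Dn|apply: DF; apply: rD].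
    split=> [x y sx sy|x y u v sx sy su sv].
      rewrite /F'; case: asboolP => [[Dx Dy]|_]; first by left; apply: DF.
      by right; exists (F (tag x y) (F (r x) (r y))) => //; apply: DFr.
    rewrite /F'; case: asboolP => [[Dx Dy]|nxy]; case: asboolP => [[Du Dv]|nuv].
    - exact: FI.
    - by move=> Fg; exfalso; apply: (gD _ (DFr u v su sv)); rewrite -Fg; apply: DF.
    - by move=> Fg; exfalso; apply: (gD _ (DFr x y sx sy)); rewrite Fg; apply: DF.
    move=> /(gI _ _ (DFr x y sx sy) (DFr u v su sv)).
    have DFr' a b : (D `|` g @` D) a -> (D `|` g @` D) b -> D (F (r a) (r b)).
      by move=> sa sb; apply: DF; apply: rD.
    move=> /(FI _ _ _ _ (Dn _) (DFr' _ _ sx sy) (Dn _) (DFr' _ _ su sv)) [tagE].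
    move=> /(FI _ _ _ _ (rD _ sx) (rD _ sy) (rD _ su) (rD _ sv)) [xu yv].
    move: tagE => /nI tagE.
    have xuD : D x <-> D u.
      by move: tagE; case: (asboolP (D x)); case: (asboolP (D u));
        case: (asboolP (D y)); case: (asboolP (D v)).
    split; first exact: rI.
    apply: rI => //; move: tagE nxy nuv xuD.
    case: (asboolP (D x)); case: (asboolP (D u));
        case: (asboolP (D y)); case: (asboolP (D v)) => ? ? ? ? //=; tauto.
  have /asboolP[/= sD _] : R s (D, F).
    apply: (max s) => //; apply/asboolP; split=> [x|x y Dx Dy] /=; first by left.
    by rewrite /F'; case: asboolP => // -[].
  by exfalso; apply: (gD (n 0%N)) => //; apply: sD; right; exists (n 0%N).
move=> /(card_le_injE (n 0%N))[g [gD gI]].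
(* Here the complement of [D] injects into [D], so [h] embeds the whole type into [D], the first
   argument of [F] keeping the two pieces apart. *)
pose h x := if `[< D x >] then F (n 0%N) x else F (n 1%N) (g x).
have hD x : D (h x).
  rewrite /h; case: asboolP => [Dx|Dx]; apply: DF => //; exact: gD.
have hI : injective h.
  move=> x y; rewrite /h; case: asboolP => [Dx|Dx]; case: asboolP => [Dy|Dy].
  - by move=> /FI [].
  - by move=> /FI [] // => [|/nI]; first exact: gD.
  - by move=> /FI [] // => [|/nI]; first exact: gD.
  - by move=> /FI [] // => [||_]; [exact: gD|exact: gD|apply: gI].
apply: (@card_leT_inj _ _ (fun xy => F (h xy.1) (h xy.2))) => -[x y] [u v] /=.
by move=> /FI [] // => /hI-> /hI->.
Qed.

Section InfiniteTarget.
Variables (T : Type).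
Hypothesis Tinf : infinite_set [set: T].

Lemma infinite_prod_le U V : [set: U] #<= [set: T] -> [set: V] #<= [set: T] ->
  [set: U * V] #<= [set: T].
Proof.
move=> UT VT; exact: card_le_trans (card_le_prod UT VT) (infinite_square Tinf).
Qed.

Lemma infinite_nat_le : [set: nat] #<= [set: T].
Proof. exact/infiniteP. Qed.

Lemma infinite_sum_le U V : [set: U] #<= [set: T] -> [set: V] #<= [set: T] ->
  [set: U + V] #<= [set: T].
Proof.
move=> UT VT; apply: card_le_trans (card_le_sum UT VT) _.
apply: card_le_trans (infinite_prod_le infinite_nat_le (card_lexx [set: T])).
apply: (@card_leT_inj _ _ (fun x => match x with
  | inl t => (0%N, t) | inr t => (1%N, t) end)).
by move=> [x|x] [y|y] //= [->].
Qed.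

Lemma infinite_bigcup_le I U (F : I -> set U) : [set: I] #<= [set: T] ->
  (forall i, F i #<= [set: T]) -> \bigcup_i F i #<= [set: T].
Proof.
move=> IT FT; have [n nI] := infinite_nat_inj Tinf.
have /choice[f fP] i := card_le_injE (n 0%N) (FT i).
have [[i0]|nI0] := pselect (inhabited I); last first.
  by rewrite bigcup0 // => i; case: nI0.
have /choice[k kP] u : exists i, (\bigcup_i F i) u -> F i u.
  have [[i _ Fu]|nu] := pselect ((\bigcup_i F i) u); first by exists i.
  by exists i0.
apply: card_le_trans (infinite_prod_le IT (card_lexx [set: T])).
apply: (@card_le_inj _ _ _ _ (fun u => (k u, f (k u) u))) => // u v Fu Fv [kuv].
have [_ fI] := fP (k v); rewrite kuv; apply: fI; last exact: kP.
by rewrite -kuv; apply: kP.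
Qed.

Lemma infinite_setU_le U (A B : set U) : A #<= [set: T] -> B #<= [set: T] ->
  A `|` B #<= [set: T].
Proof.
move=> AT BT; rewrite -bigcup2inE.
apply: (@card_le_trans _ _ _ (\bigcup_i bigcup2 A B i)).
  by apply: subset_card_le => x [i _ Fx]; exists i.
apply: infinite_bigcup_le; first exact: infinite_nat_le.
by move=> [|[|i]] //=; apply: card_ge0.
Qed.

(** Sequences are coded by iterated pairing. The size is recorded as well, because [enc] alone need
    not reveal where a sequence ends. *)
Lemma infinite_seq_le U : [set: U] #<= [set: T] -> [set: seq U] #<= [set: T].
Proof.
move=> /card_leT_injE[f fI].
have /card_leT_injE[p pI] := infinite_square Tinf.
have [n nI] := infinite_nat_inj Tinf.
pose enc := fix enc s := if s is x :: s' then p (f x, enc s') else n 0%N.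
apply: (@card_leT_inj _ _ (fun s => p (n (size s), enc s))) => s t /pI[] /nI.
by elim: s t => [|x s IH] [|y t] //= [st] /pI[/fI-> /(IH _ st)->].
Qed.

End InfiniteTarget.

Lemma card_ltNge T U (A : set T) (B : set U) : card_lt A B <-> ~ (B #<= A).
Proof.
rewrite /card_lt; split=> [/andP[AB /negP nAB] BA|nBA].
  by apply: nAB; apply/card_eqPle.
have [AB|//] := card_le_total_set A B; rewrite AB /=; apply/negP => /card_eqPle[_].
exact: nBA.
Qed.

(** * Traces on initial segments of a strong limit cardinal *)

Section StrongLimit.
Variables (d : Order.disp_t) (M : orderType d).
Hypotheses (M_card : cardinal M) (M_strong_limit : strong_limit M).
Hypotheses (M_singular : singular M) (M_cof : has_cofinality M [set: nat]).

Local Notation seg := (@initial_segment _ M).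

Lemma M_infinite : infinite_set [set: M].
Proof. by case: M_singular. Qed.

Lemma M_inhabited : M.
Proof. by have [f _] := cid (infinite_nat_inj M_infinite); exact: f 0%N. Qed.

Lemma seg_small (a : M) : ~ ([set: M] #<= seg a).
Proof. by have [_ /(_ a)/card_ltNge] := M_card. Qed.

(** A singular cardinal exceeds its cofinality, which is countable here. *)
Lemma nat_small : ~ ([set: M] #<= [set: nat]).
Proof.
have [_ [A [[C0 C0cof C0A] Amin] AM]] := M_singular.
have [[C Ccof Cnat] natmin] := M_cof.
have natA : [set: nat] #<= A by rewrite -(card_le_eqr C0A); apply: natmin.
move=> Mnat; move/card_ltNge : AM; apply; exact: card_le_trans Mnat natA.
Qed.

Lemma power_small (N : Type) : ~ ([set: M] #<= [set: N]) ->
  ~ ([set: M] #<= [set: set N]).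
Proof. by move=> /card_ltNge/M_strong_limit/card_ltNge. Qed.

(** With a largest [a], singletons for the elements below [a] and the empty set for [a] itself would
    embed [M] into the power set of [seg a], against the strong limit property. *)
Lemma no_max (a : M) : exists b, (a < b)%O.
Proof.
apply: contrapT => nb.
have amax b : b <> a -> (b < a)%O.
  by case: (ltgtP b a) => // ab _; case: nb; exists b.
have /power_small : ~ ([set: M] #<= [set: seg a]).
  by rewrite (card_le_eqr (card_setT _)); apply: seg_small.
apply; apply: (@card_leT_inj _ _ (fun m => [set x : seg a | val x = m])).
move=> m m' mm'.
have H x y : [set z : seg a | val z = x] = [set z : seg a | val z = y] ->
    (x < a)%O -> x = y.
  move=> xy xa; pose z : seg a := exist _ x (mem_set (xa : seg a x)).
  have : [set z : seg a | val z = x] z by [].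
  by rewrite xy.
have [ma|/eqP ma] := eqVneq m a; last exact/H/amax.
have [m'a|/eqP m'a] := eqVneq m' a; first by rewrite ma m'a.
by apply/esym; apply: H; [apply/esym|exact: amax].
Qed.

(** Running maxima of an enumeration of a countable cofinal set; the bound is strict because [M] has
    no largest element. *)
Lemma cofinal_seq : exists2 c : nat -> M,
  {homo c : m n / (m <= n)%N >-> (m <= n)%O} & forall a, exists n, (a < c n)%O.
Proof.
have [[C Ccof /card_eqPle[/(card_le_injE 0%N)[f [_ fI]] _]] _] := M_cof.
have /choice[g gP] n : exists x, forall y, C y -> f y = n -> x = y.
  have [[x [Cx fx]]|nx] := pselect (exists x, C x /\ f x = n).
    by exists x => y Cy fy; apply: fI => //; rewrite fx.
  by exists M_inhabited => y Cy fy; case: nx; exists y.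
pose c := fix c n := if n is n'.+1 then Order.max (c n') (g n) else g 0%N.
have gc n : (g n <= c n)%O by case: n => //= n; rewrite le_max lexx orbT.
exists c; first by apply: homo_leq => [x|y x z|n] //=; [exact: le_trans|rewrite le_max lexx].
move=> a; have [b ab] := no_max a; have [y Cy xy] := Ccof b.
exists (f y); apply: lt_le_trans ab _; apply: le_trans xy _.
by have := gc (f y); rewrite (gP (f y) y).
Qed.

(** Such a sequence is a subset of [nat * seg a], which is countable or of the size of [seg a],
    hence smaller than [M]; the strong limit property does the rest. *)
Lemma seg_power_seq_le (a : M) : [set: nat -> set (seg a)] #<= [set: M].
Proof.
apply: (@card_le_trans _ _ _ [set: set (nat * seg a)]).
  apply: (@card_leT_inj _ _ (fun f => [set p | f p.1 p.2])) => f g fg.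
  apply/funext => n; apply/funext => x; have := congr1 (fun S => S (n, x)) fg.
  by [].
apply: card_leNge; apply: power_small => MS.
have [fin|inf] := pselect (finite_set [set: seg a]).
  apply: nat_small; apply: card_le_trans MS _.
  by apply: (infinite_prod_le infinite_nat) => //; apply: finite_set_countable.
apply: (@seg_small a); rewrite -(card_le_eqr (card_setT _)).
apply: card_le_trans MS _; apply: (infinite_prod_le inf) => //.
exact: infinite_nat_le.
Qed.

Lemma subsets_seg_le (a : M) : [set u | u `<=` seg a] #<= [set: set (seg a)].
Proof.
apply: (@card_le_inj _ _ _ _ (fun u : set M => val @^-1` u)) => // u v ua va uv.
have H m (ma : seg a m) : u m = v m.
  pose z : seg a := exist _ m (mem_set ma).
  exact: (congr1 (fun S => S z) uv).
by apply/seteqP; split=> m um; [rewrite -H|rewrite H]; auto.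
Qed.

Definition nodes : set (M * set M) := [set p | p.2 `<=` seg p.1].

Lemma nodes_le : nodes #<= [set: M].
Proof.
apply: (@card_le_trans _ _ _ (\bigcup_a (pair a @` [set u | u `<=` seg a]))).
  by apply: subset_card_le => -[a u] au; exists a => //; exists u.
apply: (infinite_bigcup_le M_infinite) => // a.
apply: card_le_trans (card_image_le _ _) _.
apply: card_le_trans (subsets_seg_le a) _.
apply: card_le_trans (seg_power_seq_le a).
by apply: (@card_leT_inj _ _ (fun u _ => u)) => u v /(congr1 (@^~ 0%N)).
Qed.

Variables (T : Type) (e : T -> set M).
Hypothesis e_inj : injective e.

Definition large (D : set T) := ~ (D #<= [set: M]).

(** Pigeonhole: [#|M|] sets of size [#|M|] have a union of size at most [#|M|]. *)
Lemma large_bigcup (I : Type) (J : set I) (D : set T) (F : I -> set T) : large D ->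
  J #<= [set: M] -> D `<=` \bigcup_(i in J) F i -> exists2 i, J i & large (F i).
Proof.
move=> lD JM DF; apply: contrapT => nF; apply: lD.
apply: (@card_le_trans _ _ _ (\bigcup_(i : J) F (val i))).
  by apply: subset_card_le => x /DF[i Ji Fx]; exists (exist _ i (mem_set Ji)).
apply: (infinite_bigcup_le M_infinite); first by rewrite (card_le_eql (card_setT _)).
move=> i; apply: contrapT => lF; apply: nF; exists (val i) => //; exact: set_valP.
Qed.

Lemma large_two (D : set T) : large D -> exists x y, [/\ D x, D y & x <> y].
Proof.
move=> lD; apply: contrapT => nxy; apply: lD.
apply: (@card_le_inj _ _ _ _ (fun=> M_inhabited)) => // x y Dx Dy _.
by apply: contrapT => xy; apply: nxy; exists x, y.
Qed.

(* Subsets of [M] are the branches of a tree whose nodes at level [a] are the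
   traces on [seg a]; [fib D a u] is the part of [D] lying above the node [u]. *)
Definition fib (D : set T) (a : M) (u : set M) : set T :=
  D `&` [set x | e x `&` seg a = u].

Definition big (D : set T) a u := large (fib D a u).

Lemma seg_le (a b : M) : (a <= b)%O -> seg a `<=` seg b.
Proof. by move=> ab x xa; apply: lt_le_trans xa ab. Qed.

Lemma seg_cap (a b : M) u : (a <= b)%O -> u `&` seg b `&` seg a = u `&` seg a.
Proof. by move=> ab; rewrite -setIA (setIidr (seg_le ab)). Qed.

(** Every element of [M] lies strictly below some level of [P], as [M] has no largest element. *)
Lemma trace_ext (u v : set M) (P : set M) : (forall a, exists2 b, (a <= b)%O & P b) ->
  (forall b, P b -> u `&` seg b = v `&` seg b) -> u = v.
Proof.
move=> Pcof uv.
suff H u' v' : (forall b, P b -> u' `&` seg b = v' `&` seg b) -> u' `<=` v'.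
  by apply/seteqP; split; apply: H => // b Pb; rewrite uv.
move=> uv' m um; have [b mb] := no_max m; have [b' bb' Pb'] := Pcof b.
have : (u' `&` seg b') m by split=> //; apply: lt_le_trans mb bb'.
by rewrite uv' // => -[].
Qed.

(* If not, the part of [fib D a u] all of whose traces are big would inject
   into [nat -> set (seg b)], which is smaller than [M]. *)
Lemma big_branching D a u b : big D a u -> exists a' (i : set M -> set M),
  [/\ (a <= a')%O, (b <= a')%O, forall z, i z `&` seg a = u /\ big D a' (i z) &
      forall z z', i z = i z' <-> z `&` seg b = z' `&` seg b].
Proof.
move=> bigu; apply: contrapT => nbr.
pose L a' := [set v | v `&` seg a = u /\ big D a' v].
(* A level with at least as many big nodes above [u] as [seg b] has subsets would give the
   branching: index big nodes of that level by traces on [seg b]. *)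
have LP a' : (a <= a')%O -> (b <= a')%O -> L a' #<= [set: set (seg b)].
  move=> aa' ba'; have [//|bL] := card_le_total_set (L a') [set: set (seg b)].
  exfalso; apply: nbr; have [f [fL fI]] := card_le_injE u bL.
  exists a', (fun z => f (val @^-1` z)); split=> // z; first exact: fL.
  move=> z'; split=> [/fI zz'|zz'].
    have {}zz' m (mb : seg b m) : z m = z' m.
      exact: (congr1 (fun S => S (exist _ m (mem_set mb))) (zz' Logic.I Logic.I)).
    by apply/seteqP; split=> m [zm mb]; split=> //; [rewrite -zz'|rewrite zz'].
  congr f; apply/seteqP; split=> m /= zm.
    have : (z `&` seg b) (val m) by split=> //; exact: set_valP.
    by rewrite zz' => -[].
  have : (z' `&` seg b) (val m) by split=> //; exact: set_valP.
  by rewrite -zz' => -[].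
have [c cmono ccof] := cofinal_seq.
pose m n := Order.max (Order.max a b) (c n).
have am n : (a <= m n)%O by rewrite !le_max lexx.
have bm n : (b <= m n)%O by rewrite !le_max lexx orbT.
have /choice[f fP] n := card_le_injE set0 (LP (m n) (am n) (bm n)).
pose H := [set x | fib D a u x /\ forall a', big D a' (e x `&` seg a')].
have HM : H #<= [set: M].
  apply: card_le_trans (seg_power_seq_le b).
  apply: (@card_le_inj _ _ _ _ (fun x n => f n (e x `&` seg (m n)))) => // x y.
  move=> [[Dx xu] xbig] [[Dy yu] ybig] fxy; apply: e_inj.
  apply: (@trace_ext _ _ (range m)).
    move=> a0; have [n a0n] := ccof a0; exists (m n); last by exists n.
    by rewrite le_max (ltW a0n) orbT.
  move=> _ [n _ <-]; have [_ fI] := fP n; apply: fI.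
  - by split; rewrite ?seg_cap.
  - by split; rewrite ?seg_cap.
  - exact: (congr1 (@^~ n) fxy).
pose small := [set p | nodes p /\ ~ big D p.1 p.2].
(* There are at most [#|M|] nodes that are not big. Their fibres together with [H], indexed by
   [None], cover the big fibre, although none of them is large. *)
have [|x|i] := @large_bigcup (option (M * set M))
    [set o | if o is Some p then small p else True] (fib D a u)
    (fun o => if o is Some p then fib D p.1 p.2 else H) bigu.
- apply: (@card_le_trans _ _ _ ([set None] `|` some @` small)).
    by apply: subset_card_le => -[p|] op /=; [right; exists p|left].
  apply: (infinite_setU_le M_infinite).
    by apply: (@card_le_inj _ _ _ _ (fun=> M_inhabited)) => // x y -> ->.
  apply: card_le_trans (card_image_le _ _) _; apply: card_le_trans nodes_le.
  by apply: subset_card_le => p [].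
- move=> ux; have [xbig|/existsNP[a' xa']] :=
    pselect (forall a', big D a' (e x `&` seg a')); first by exists None.
  exists (Some (a', e x `&` seg a')); first by split=> //= y [].
  by case: ux.
by case: i => [p [_ ?]|_].
Qed.

(** * Convergence of sets of points, and the limits of a large set *)

Definition conv (S : set T) (y : set M) :=
  forall a, finite_set (S `&` [set x | e x `&` seg a <> y `&` seg a]).

Lemma conv_sub S S' y : S' `<=` S -> conv S y -> conv S' y.
Proof. by move=> SS Sy a; apply: sub_finite_set (Sy a) => x [/SS]. Qed.

(** At a level separating the two limits, a common point departs from one of them, and only finitely
    many points do so. *)
Lemma conv_uniq S S' y y' : conv S y -> conv S' y' -> y <> y' ->
  finite_set (S `&` S').
Proof.
move=> Sy Sy' yy'.
have [a ya] : exists a, y `&` seg a <> y' `&` seg a.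
  apply: contrapT => na; apply: yy'; apply: (@trace_ext _ _ setT).
    by move=> a; exists a.
  by move=> b _; apply: contrapT => yb; apply: na; exists b.
apply: (@sub_finite_set _ _ ((S `&` [set x | e x `&` seg a <> y `&` seg a])
    `|` (S' `&` [set x | e x `&` seg a <> y' `&` seg a]))).
  move=> x [Sx S'x]; have [xy|xy] := pselect (e x `&` seg a = y `&` seg a).
    by right; split=> //=; rewrite xy.
  by left.
by rewrite finite_setU; split.
Qed.

(** A path of big nodes is built in omega steps for each [z], the node at step [n.+1] being chosen
    by the trace of [z] on [seg (c n)]. The levels reached are cofinal, so the union [J z] passes
    through big nodes cofinally often; it determines the path, hence every trace of [z]. *)
Lemma big_limits D : large D -> exists2 J : set M -> set M, injective J &
  forall z a, exists2 a', (a <= a')%O & big D a' (J z `&` seg a').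
Proof.
move=> lD; have [c cmono ccof] := cofinal_seq.
have [u0 _ bigu0] : exists2 u, [set u | u `<=` seg (c 0%N)] u & big D (c 0%N) u.
  apply: (large_bigcup lD).
    apply: card_le_trans nodes_le.
    by apply: (@card_le_inj _ _ _ _ (pair (c 0%N))) => // u v _ _ [].
  by move=> x Dx; exists (e x `&` seg (c 0%N)) => // y [].
have /choice[st stP] (nau : nat * (M * set M)) : exists (ai : M * (set M -> set M)),
    big D nau.2.1 nau.2.2 ->
    [/\ (nau.2.1 <= ai.1)%O, (c nau.1 <= ai.1)%O,
        forall z, ai.2 z `&` seg nau.2.1 = nau.2.2 /\ big D ai.1 (ai.2 z) &
      forall z z', ai.2 z = ai.2 z' <-> z `&` seg (c nau.1) = z' `&` seg (c nau.1)].
  case: nau => n [a u] /=.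
  have [bigu|nbig] := pselect (big D a u); last by exists (a, id).
  by have [a' [i Hi]] := big_branching (c n) bigu; exists (a', i).
pose s z := fix s n := if n is n'.+1 then
   ((st (n', s n')).1, (st (n', s n')).2 z) else (c 0%N, u0).
have sbig z n : big D (s z n).1 (s z n).2.
  by elim: n => //= n IH; have [_ _ /(_ z)[]] := stP (n, s z n) IH.
have sle z : {homo (fun n => (s z n).1) : m n / (m <= n)%N >-> (m <= n)%O}.
  apply: homo_leq => [x|y x w|n] //=; first exact: le_trans.
  by have [] := stP (n, s z n) (sbig z n).
have sc z n : (c n <= (s z n.+1).1)%O.
  by have [] := stP (n, s z n) (sbig z n).
have scap z m n : (m <= n)%N -> (s z n).2 `&` seg (s z m).1 = (s z m).2.
  have sub k : (s z k).2 `&` seg (s z k).1 = (s z k).2.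
    have [x [_ [[_ <-] _ _]]] := large_two (sbig z k).
    by rewrite -setIA setIid.
  move=> mn; rewrite -(subnK mn); elim: (n - m)%N => [|k IH]; first exact: sub.
  have [_ _ /(_ z)[H _] _] := stP ((k + m)%N, s z (k + m)%N) (sbig z _).
  rewrite addSn /= -[RHS]IH -H -setIA; congr (_ `&` _); apply/esym/setIidr.
  by apply: seg_le; apply: sle; rewrite leq_addl.
pose J z := \bigcup_n (s z n).2.
have JE z n : J z `&` seg (s z n).1 = (s z n).2.
  apply/seteqP; split=> [m [[k _ km] mn]|m mn].
    have [kn|/ltnW nk] := leqP k n; last by rewrite -(scap z n k nk).
    by move: km; rewrite -(scap z k n kn) => -[].
  by split; [exists n|move: mn; rewrite -(scap z n n) // => -[]].
exists J.
  move=> z z' zz'.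
  (* The level at step [n.+1] depends only on the node at step [n], and the node there is the trace
     of the common limit. *)
  have sE n : s z n = s z' n.
    elim: n => //= n IH.
    have H : (s z n.+1).2 = (s z' n.+1).2.
      by rewrite -!JE zz' /= IH.
    by rewrite IH; congr pair; rewrite /= IH in H.
  apply: (@trace_ext _ _ (range c)).
    by move=> a; have [n an] := ccof a; exists (c n); [exact: ltW|exists n].
  move=> _ [n _ <-]; have [_ _ _ H] := stP (n, s z n) (sbig z n); apply/H.
  by have /= := congr1 snd (sE n.+1); rewrite -sE.
move=> z a; have [n an] := ccof a; exists (s z n.+1).1.
  exact: le_trans (ltW an) (sc z n).
by rewrite JE.
Qed.

(** [D0] consists of two points from each big fibre. Of the two points taken in a fibre along [J z],
    one is not sent to [J z] by [e]; such points, taken at cofinally many levels, converge to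
    [J z]. *)
Lemma large_limits D : large D -> exists D0, [/\ D0 `<=` D, D0 #<= [set: M] &
  exists2 J : set M -> set M, injective J &
    forall z, exists S, [/\ S `<=` D0, infinite_set S & conv S (J z)]].
Proof.
move=> lD; have [J JI Jbig] := big_limits lD.
have [x0 _] := large_two lD.
have /choice[p pP] (au : M * set M) : exists xy : T * T, big D au.1 au.2 ->
    [/\ fib D au.1 au.2 xy.1, fib D au.1 au.2 xy.2 & xy.1 <> xy.2].
  have [bigu|nbig] := pselect (big D au.1 au.2); last by exists (x0, x0).
  by have [x [y xyP]] := large_two bigu; exists (x, y).
pose B := [set au | nodes au /\ big D au.1 au.2].
have BM : B #<= [set: M].
  by apply: card_le_trans nodes_le; apply: subset_card_le => au [].
exists ((fst \o p) @` B `|` (snd \o p) @` B); split.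
- by move=> x [] [au [_ /pP[[D1 _] [D2 _] _]] <-].
- by apply: (infinite_setU_le M_infinite); apply: card_le_trans BM;
    apply: card_image_le.
exists J => // z; have [c cmono ccof] := cofinal_seq.
have /choice[a aP] n : exists a, (c n <= a)%O /\ big D a (J z `&` seg a).
  by have [a ca ba] := Jbig z (c n); exists a.
have /choice[x xP] n : exists x, [/\ ((fst \o p) @` B `|` (snd \o p) @` B) x,
    e x <> J z & e x `&` seg (a n) = J z `&` seg (a n)].
  have [ca bigy] := aP n; pose au := (a n, J z `&` seg (a n)).
  have [[/= D1 e1] [/= D2 e2] ne] := pP au bigy.
  have Bau : B au by split=> //= y [].
  have [e1J|e1J] := pselect (e (p au).1 = J z).
    exists (p au).2; split=> //; first by right; exists au.
    by move=> e2J; apply: ne; apply: e_inj; rewrite e1J.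
  by exists (p au).1; split=> //; left; exists au.
exists (range x); split.
- by move=> _ [n _ <-]; have [] := xP n.
(* No point is chosen infinitely often: some level [b] separates it from [J z], while the points
   chosen at late stages agree with [J z] on [seg b]. *)
- move=> fin; apply: infinite_nat.
  apply: (@sub_finite_set _ _ (\bigcup_(t in range x) [set n | x n = t])).
    by move=> n _; exists (x n) => //; exists n.
  apply: bigcup_finite => // _ [k _ <-].
  have [_ kJ _] := xP k.
  have [b kb] : exists b, e (x k) `&` seg b <> J z `&` seg b.
    apply: contrapT => nb; apply: kJ; apply: (@trace_ext _ _ setT).
      by move=> b; exists b.
    by move=> b _; apply: contrapT => kb; apply: nb; exists b.
  have [N bN] := ccof b; apply: (@sub_finite_set _ _ `I_N); last exact: finite_II.
  move=> n /= nk; rewrite ltnNge; apply/negP => Nn; apply: kb.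
  have [_ _] := xP n; rewrite nk => /(congr1 (fun u => u `&` seg b)).
  rewrite !seg_cap //; have [ca _] := aP n; apply: le_trans ca;
    exact: le_trans (ltW bN) (cmono _ _ Nn).
move=> b; have [N bN] := ccof b.
apply: (@sub_finite_set _ _ (x @` `I_N)); last exact/finite_image/finite_II.
move=> _ [[n _ <-] /= nb]; exists n => //=; rewrite ltnNge; apply/negP => Nn.
apply: nb; have [_ _ /(congr1 (fun u => u `&` seg b))] := xP n.
rewrite !seg_cap //; have [ca _] := aP n; apply: le_trans ca;
  exact: le_trans (ltW bN) (cmono _ _ Nn).
Qed.

End StrongLimit.

(** * Sets that are not split *)

Definition nosplit T (S b : set T) := finite_set (S `&` b) \/ finite_set (S `\` b).

Lemma nosplit_sub T (S S' b : set T) : S' `<=` S -> nosplit S b -> nosplit S' b.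
Proof.
move=> SS [fin|fin]; [left|right]; apply: sub_finite_set fin => x [Sx bx];
  by split=> //; apply: SS.
Qed.

Lemma nosplitC T (S b : set T) : nosplit S b -> nosplit S (~` b).
Proof. by move=> [fin|fin]; [right|left]; rewrite ?setDE ?setCK. Qed.

Lemma nosplitI T (S b c : set T) : nosplit S b -> nosplit S c -> nosplit S (b `&` c).
Proof.
move=> [fb|fb]; first by left; apply: sub_finite_set fb => x [Sx []].
move=> [fc|fc]; first by left; apply: sub_finite_set fc => x [Sx []].
by right; rewrite setDIr finite_setU.
Qed.

Lemma nosplit_self T (S : set T) : nosplit S S.
Proof. by right; rewrite setDv. Qed.

Lemma sub_image_preimage T U (g : T -> U) (S : set T) (R : set U) :
  R `<=` g @` S -> g @` (S `&` g @^-1` R) = R.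
Proof.
move=> RS; apply/seteqP; split=> [_ [x [_ Rx] <-] //|r Rr].
by have [x Sx xr] := RS r Rr; exists x => //; split; rewrite //= xr.
Qed.

Lemma infinite_image_inj T U (g : T -> U) (S : set T) :
  (forall x y, S x -> S y -> g x = g y -> x = y) -> infinite_set S ->
  infinite_set (g @` S).
Proof.
move=> gI Sinf fin; apply: Sinf; apply: card_le_finite fin.
by apply: (@card_le_inj _ _ _ _ g) => // x Sx; exists x.
Qed.

Lemma infinite_halves T (S : set T) : infinite_set S ->
  exists P, [/\ P `<=` S, infinite_set P & infinite_set (S `\` P)].
Proof.
move=> Sinf; have [x0 _] := infinite_setN0 Sinf.
have /(card_le_injE x0)[n [nS nI]] := (infiniteP S).1 Sinf.
have {}nI : injective n by move=> i j; apply: nI.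
exists (range (n \o double)); split.
- by move=> _ [k _ <-]; apply: nS.
- apply: infinite_image_inj infinite_nat => i j _ _ /nI.
  exact: double_inj.
apply: (@sub_infinite_set _ (range (n \o (fun k => k.*2.+1)))).
  move=> _ [k _ <-]; split; first exact: nS.
  by move=> [j _ /nI /(congr1 odd)]; rewrite /= !odd_double.
by apply: infinite_image_inj infinite_nat => i j _ _ /nI [] /double_inj.
Qed.

(** * The almost disjoint family *)

Section Selection.
Variables (d : Order.disp_t) (M : orderType d).
Hypotheses (M_card : cardinal M) (M_strong_limit : strong_limit M).
Hypotheses (M_singular : singular M) (M_cof : has_cofinality M [set: nat]).

Lemma sets_infinite : infinite_set [set: set M].
Proof.
apply/infiniteP; apply: card_le_trans (infinite_nat_le (M_infinite M_singular)) _.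
apply: (@card_leT_inj _ _ (fun m => [set m])) => m m' mm'.
by have : [set m] m by []; rewrite mm'.
Qed.

(** Here [(2 ^ mu) ^ mu = 2 ^ (mu * mu) = 2 ^ mu]. *)
Lemma arrow_sets_le U : [set: U] #<= [set: set M] ->
  [set: M -> U] #<= [set: set M].
Proof.
move=> UM; apply: card_le_trans (card_le_arrow M UM) _.
apply: (@card_le_trans _ _ _ [set: set (M * M)]).
  apply: (@card_leT_inj _ _ (fun f => [set p | f p.1 p.2])) => f g fg.
  apply/funext => n; apply/funext => x; exact: (congr1 (fun S => S (n, x)) fg).
exact/card_le_sets/infinite_square/M_infinite.
Qed.

Variables (T : Type) (e : T -> set M).
Hypothesis e_inj : injective e.
Variable L : set (set T).
Hypothesis thin : forall S, infinite_set S -> exists S',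
  [/\ S' `<=` S, infinite_set S' & forall l, L l -> nosplit S' l].

Local Notation large := (large M).
Local Notation conv := (conv e).
Local Notation Code := ((M -> T) * (M -> T))%type.

(** A partial function with at most [#|M|] arguments is coded by listing its graph along [M],
    repetitions allowed; this keeps the number of codes down to [2 ^ #|M|]. *)
Definition code_dom (c : Code) : set T := range c.1.

(* The partial function with graph [{(c.1 m, c.2 m)}]. *)
Definition code_fun (c : Code) (x : T) : T :=
  c.2 (xget (M_inhabited M_singular) [set m | c.1 m = x]).

Definition valid (c : Code) :=
  [/\ forall x y, code_dom c x -> code_dom c y -> code_fun c x = code_fun c y ->
        x = y,
      forall x, code_dom c x -> ~ code_dom c (code_fun c x) &
      exists2 J : set M -> set M, injective J & forall z, exists S,
        [/\ S `<=` code_dom c, infinite_set S & conv S (J z)]].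

(* [whole] exceeds [part] by an infinite set, so that an algebra containing the
   image of [part] must split the image of [whole]. *)
Record choice_data := ChoiceData {
  lim : set M; img_lim : set M; whole : set T; part : set T }.

(** A limit differing from all earlier limits makes [part a] almost disjoint from the earlier parts;
    its differing from the earlier image limits keeps [part a] almost disjoint from the earlier
    images. The two alternatives on the image of [whole a] prepare its comparison with later and
    with earlier parts. *)
Definition selects (lt : set M -> set M -> Prop) (dec : set M -> Code) (i : set M)
    (F : set M -> choice_data) (a : choice_data) : Prop :=
  let g := code_fun (dec i) in
  (~ valid (dec i) -> part a = set0) /\
  (valid (dec i) ->
   [/\ [/\ whole a `<=` code_dom (dec i), conv (whole a) (lim a),
           forall l, L l -> nosplit (whole a) l &
           forall l, L l -> nosplit (g @` whole a) l],
       [/\ part a `<=` whole a, infinite_set (part a) &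
           infinite_set (whole a `\` part a)],
       forall j, lt j i -> lim a <> lim (F j) /\ lim a <> img_lim (F j),
       conv (g @` whole a) (img_lim a) \/
         forall R y, R `<=` g @` whole a -> infinite_set R -> ~ conv R y &
       (exists2 j, lt j i & g @` whole a `<=` part (F j)) \/
         forall j, lt j i -> finite_set (g @` whole a `&` part (F j))]).

Lemma exists_selection lt dec i F :
  (~ ([set: set M] #<= [set j | lt j i])) ->
  exists a, selects lt dec i F a.
Proof.
move=> small; pose g := code_fun (dec i).
have [v|nv] := pselect (valid (dec i)); last first.
  by exists (ChoiceData set0 set0 set0 set0); split.
have [gI gD [J JI JP]] := v.
have [z zP] : exists z, forall j, lt j i ->
    J z <> lim (F j) /\ J z <> img_lim (F j).
  apply: contrapT => nz.
  (* Otherwise every [J z] is one of the two limits of an earlier stage, and injectivity of [J]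
     makes the earlier stages as numerous as the subsets of [M]. *)
  have /choice[h hP] z : exists jb : set M * bool, lt jb.1 i /\
      J z = if jb.2 then lim (F jb.1) else img_lim (F jb.1).
    apply: contrapT => nj; apply: nz; exists z => j ji.
    by split=> Jz; apply: nj; [exists (j, true)|exists (j, false)].
  have le : [set: set M] #<= [set: [set j | lt j i] * bool].
    pose h1 z : [set j | lt j i] := exist _ (h z).1 (mem_set (hP z).1).
    apply: (@card_leT_inj _ _ (fun z => (h1 z, (h z).2))) => z z' [h1E h2E].
    by apply: JI; rewrite (hP z).2 (hP z').2 h1E h2E.
  have [fin|inf] := pselect (finite_set [set: [set j | lt j i]]).
    apply: sets_infinite; apply: card_le_finite le _.
    rewrite -setXTT; apply: finite_setX => //; exact: finite_finset.
  apply: small; rewrite -(card_le_eqr (card_setT _)).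
  apply: card_le_trans le _; apply: (infinite_prod_le inf) => //.
  by apply: card_le_trans (infinite_nat_le inf); apply: countableP.
have [S0 [S0D S0inf S0c]] := JP z.
have img S : S `<=` S0 -> infinite_set S -> infinite_set (g @` S).
  move=> SS; apply: infinite_image_inj => x y Sx Sy.
  by apply: gI; apply: S0D; apply: SS.
have pre S R : R `<=` g @` S -> infinite_set R ->
    exists S', [/\ S' `<=` S, infinite_set S' & g @` S' = R].
  move=> RS Rinf; exists (S `&` g @^-1` R); split; first by move=> x [].
    move=> fin; apply: Rinf; rewrite -(sub_image_preimage RS).
    exact: finite_image.
  exact: sub_image_preimage.
(* Successive infinite subsets, each keeping what the previous ones achieved: [L] does not split the
   set, nor its image; the image converges or has no convergent infinite subset; the image lies in
   an earlier part or is almost disjoint from all of them. *)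
have [S1 [S10 S1inf S1L]] := thin S0inf.
have [R2 [R21 R2inf R2L]] := thin (img _ S10 S1inf).
have [S2 [S21 S2inf S2R]] := pre _ _ R21 R2inf.
have S20 := subset_trans S21 S10.
have [S3 [y' [S32 S3inf S3c]]] : exists S3 y', [/\ S3 `<=` S2, infinite_set S3 &
    conv (g @` S3) y' \/
    forall R y, R `<=` g @` S3 -> infinite_set R -> ~ conv R y].
  have [[R [y [RS Rinf Rc]]]|nR] := pselect (exists R y,
      [/\ R `<=` g @` S2, infinite_set R & conv R y]).
    have [S [SS Sinf SR]] := pre _ _ RS Rinf.
    by exists S, y; split=> //; left; rewrite SR.
  exists S2, set0; split=> //; right => R y RS Rinf Rc.
  by apply: nR; exists R, y.
have S30 := subset_trans S32 S20.
have [S4 [S43 S4inf S4P]] : exists S4, [/\ S4 `<=` S3, infinite_set S4 &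
    (exists2 j, lt j i & g @` S4 `<=` part (F j)) \/
         forall j, lt j i -> finite_set (g @` S4 `&` part (F j))].
  have [[j ji jinf]|nj] := pselect (exists2 j, lt j i &
      infinite_set (g @` S3 `&` part (F j))).
    have [S [SS Sinf SR]] := pre S3 _ (@subIsetl _ _ _) jinf.
    exists S; split=> //; left; exists j => //; rewrite SR; exact: subIsetr.
  exists S3; split=> //; right => j ji; apply: contrapT => jinf.
  by apply: nj; exists j.
have S40 := subset_trans S43 S30.
have [P [PS Pinf SPinf]] := infinite_halves S4inf.
have gsub S S' : S `<=` S' -> g @` S `<=` g @` S' by apply: image_subset.
exists (ChoiceData (J z) y' S4 P); split=> // _; split=> //=.
- split.
  + exact: subset_trans S40 S0D.
  + exact: conv_sub S40 S0c.
  + by move=> l /S1L; apply: nosplit_sub; apply: subset_trans S43 (subset_trans S32 S21).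
  + move=> l /R2L; apply: nosplit_sub; rewrite -S2R; apply: gsub.
    exact: subset_trans S43 S32.
- case: S3c => [c|nc]; first by left; apply: conv_sub c; apply: gsub.
  by right => R y RS; apply: nc; apply: subset_trans RS (gsub _ _ S43).
Qed.

(** Parts are selected along a well order of [set M] with small segments, through an enumeration
    [dec] that reaches every code. A given [f] is then defeated at the stage coding its restriction
    to a subset [D0] of [D] with many limits. *)
Lemma dense_family : [set: T] #<= [set: set M] -> exists P : set M -> set T,
  [/\ forall i l, L l -> nosplit (P i) l,
      forall i j, i <> j -> finite_set (P i `&` P j) &
      forall D f, large D -> (forall x y, D x -> D y -> f x = f y -> x = y) ->
        (forall x, D x -> ~ D (f x)) ->
        exists i H, [/\ P i `<=` D, f @` P i `<=` H, infinite_set (f @` P i),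
          infinite_set (H `\` f @` P i) &
          (forall l, L l -> nosplit H l) /\ (forall j, nosplit H (P j))]].
Proof.
move=> TM; have [[t0]|nT] := pselect (inhabited T); last first.
  exists (fun=> set0); split.
  - by move=> i l _; left; rewrite set0I.
  - by move=> i j _; rewrite set0I.
  - by move=> D f lD; have [x _] := large_two M_singular lD; case: nT.
have [lt [wf tr tot] small] := ex_initial_well_order (set M).
have [dec decK] : exists dec : set M -> Code, forall c, exists i, dec i = c.
  have /card_leT_injE[en enI] : [set: Code] #<= [set: set M].
    by apply: (infinite_prod_le sets_infinite); apply: arrow_sets_le.
  have /choice[dec decP] i : exists c, forall c', en c' = i -> c = c'.
    have [[c <-]|nc] := pselect (exists c, en c = i); first by exists c => c' /enI.
    by exists ((fun=> t0), (fun=> t0)) => c' c'i; case: nc; exists c'.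
  by exists dec => c; exists (en c); apply: decP.
have [||F FP] := @wf_choice _ choice_data lt (selects lt dec)
    (ChoiceData set0 set0 set0 set0) wf.
- move=> i F G a FG [nv v]; split=> // /v[H1 H2 H3 H4 H5]; split=> //.
    by move=> j ji; rewrite -FG //; apply: H3.
  case: H5 => [[j ji jP]|H5]; first by left; exists j => //; rewrite -FG.
  by right => j ji; rewrite -FG //; apply: H5.
- by move=> i F; apply/exists_selection/small.
pose P i := part (F i); exists P.
have PS i : valid (dec i) -> P i `<=` whole (F i).
  by move=> v; have [_ /(_ v)[_ []]] := FP i.
have P0 i : ~ valid (dec i) -> P i = set0 by case: (FP i).
have PL i l : L l -> nosplit (P i) l.
  move=> Ll; have [v|/P0 ->] := pselect (valid (dec i)); last by left; rewrite set0I.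
  have [_ /(_ v)[[_ _ /(_ l Ll) H _] _ _ _ _]] := FP i.
  exact: nosplit_sub (PS i v) H.
have AD i j : lt j i -> finite_set (P i `&` P j).
  move=> ji; have [v|/P0 ->] := pselect (valid (dec i)); last by rewrite set0I.
  have [v'|/P0 ->] := pselect (valid (dec j)); last by rewrite setI0.
  have [_ /(_ v)[[_ ci _ _] _ /(_ j ji)[ij _] _ _]] := FP i.
  have [_ /(_ v')[[_ cj _ _] _ _ _ _]] := FP j.
  apply: (conv_uniq M_card M_strong_limit (conv_sub (PS i v) ci)
    (conv_sub (PS j v') cj) ij).
have ADn i j : i <> j -> finite_set (P i `&` P j).
  by case: (tot i j) => [ij _|//|ji _]; [rewrite setIC|]; apply: AD.
split=> // D f lD fI fD.
have [D0 [D0D D0M [J JI JP]]] :=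
  large_limits M_card M_strong_limit M_singular M_cof e_inj lD.
have [x0 Dx0] : D0 !=set0.
  have [S [SD Sinf _]] := JP set0; have [x Sx] := infinite_setN0 Sinf.
  by exists x; apply: SD.
have [h [_ hI]] := card_le_injE (M_inhabited M_singular) D0M.
have /choice[b bP] m : exists x, D0 x /\ forall y, D0 y -> h y = m -> x = y.
  have [[x [D0x <-]]|nx] := pselect (exists x, D0 x /\ h x = m).
    by exists x; split=> // y D0y /hI yx; apply/esym/yx.
  by exists x0; split=> // y D0y hy; case: nx; exists y.
have [i iE] := decK (b, f \o b).
have bD : code_dom (dec i) = D0.
  rewrite iE; apply/seteqP; split=> [_ [m _ <-]|x D0x]; first by case: (bP m).
  by exists (h x) => //; apply: (bP (h x)).2.
have gf x : D0 x -> code_fun (dec i) x = f x.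
  rewrite -bD iE /code_fun /= => -[m _ mx]; case: xgetP => [m' _ /= -> //|].
  by move=> /(_ m).
have v : valid (dec i).
  split; rewrite bD.
  - by move=> x y D0x D0y; rewrite !gf //; apply: fI; apply: D0D.
  - by move=> x D0x; rewrite gf // => /D0D; apply: fD; apply: D0D.
  - by exists J.
have [_ /(_ v)[]] := FP i; rewrite bD; set a := F i; set g := code_fun _.
move=> [SD Sc SL gSL] [PiS Pinf SPinf] sep img early.
have gE S : S `<=` D0 -> g @` S = f @` S.
  by move=> SD0; apply/seteqP; split=> _ [x Sx <-]; exists x => //; rewrite /g gf //;
    apply: SD0.
have PD : P i `<=` D0 by apply: subset_trans PiS SD.
have fPinf : infinite_set (f @` P i).
  by apply: infinite_image_inj => // x y Px Py; apply: fI; apply: D0D; apply: PD.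
have fSPinf : infinite_set (f @` whole a `\` f @` P i).
  apply: (@sub_infinite_set _ (f @` (whole a `\` P i))).
    move=> _ [x [Sx nPx] <-]; split; first by exists x.
    move=> [y Py /fI yx]; apply: nPx; rewrite -yx //.
      by apply: D0D; apply: PD.
    by apply: D0D; apply: SD.
  by apply: infinite_image_inj => // x y [Sx _] [Sy _]; apply: fI; apply: D0D;
    apply: SD.
rewrite (gE _ SD) in gSL img early.
have fPS : f @` P i `<=` f @` whole a by apply: image_subset.
(* If the image of the whole set lies in an earlier [P j], then [P j] serves as [H], being almost
   disjoint from the other members. *)
exists i; case: early => [[j ji SPj]|early].
  exists (P j); split=> //.
  - exact: subset_trans PD D0D.
  - exact: subset_trans fPS SPj.
  - by apply: sub_infinite_set fSPinf => x [Sx nPx]; split=> //; apply: SPj.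
  split; first exact: PL.
  move=> k; have [->|jk] := pselect (j = k); first exact: nosplit_self.
  by left; apply: ADn.
(* Otherwise the image itself is [H]. Earlier parts meet it finitely by selection, and [P i] misses
   it since [f] moves [D] off itself. Later parts converge elsewhere if the image converges; if it
   has no convergent infinite subset, its intersection with a later part must be finite. *)
exists (f @` whole a); split=> //; first exact: subset_trans PD D0D.
split=> // k; left; case: (tot k i) => [ki|->|ik].
- exact: early.
- suff -> : f @` whole a `&` P i = set0 by [].
  apply/seteqP; split=> // _ [[x Sx <-] /PD/D0D Dfx]; apply: (fD x) => //.
  by apply: D0D; apply: SD.
have [v'|/P0 ->] := pselect (valid (dec k)); last by rewrite setI0.
have [_ /(_ v')[[_ ck _ _] _ /(_ i ik)[_ ki'] _ _]] := FP k.
have Pkc := conv_sub (PS k v') ck.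
case: img => [c|nc].
  apply: (conv_uniq M_card M_strong_limit c Pkc) => E; exact: ki'.
apply: contrapT => inf; apply: (nc _ (lim (F k)) _ inf); first exact: subIsetl.
exact: conv_sub (@subIsetr _ _ _) Pkc.
Qed.

End Selection.

(** * Paths of a tree *)

Section Paths.
Variables (d : Order.disp_t) (T : porderType d).
Hypothesis T_tree : tree T.

(** The common form of branches and of initial segments. *)
Definition tree_path (c : set T) : Prop :=
  (forall x y, c x -> c y -> x >=< y)%O /\
  (forall x y, c y -> (x <= y)%O -> c x).

Lemma tree_wf : well_founded (fun x y : T => x < y)%O.
Proof.
apply: min_wf => P [x Px].
have [[y [yx Py]]|ny] := pselect (exists y, (y < x)%O /\ P y); last first.
  by exists x => // y yx Py; apply: ny; exists y.
have [||z [[/andP[zx /asboolP Pz] lb] _]] :=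
  @T_tree x [pred y | (y < x)%O && `[< P y >]].
- by move=> w /andP[].
- by exists y; apply/andP; split=> //; apply/asboolP.
exists z => // w wz Pw.
have : (z <= w)%O.
  by apply: lb; apply/andP; split; [exact: lt_trans wz zx|apply/asboolP].
by move=> zw; have := lt_le_trans wz zw; rewrite ltxx.
Qed.

Lemma tree_path_initial_segment (x : T) : tree_path (initial_segment x).
Proof.
split=> [y z yx zx|y z zx yz]; last exact: le_lt_trans yz zx.
exact: (wo_chainW (@T_tree x)) yx zx.
Qed.

(** An element of [c] outside the downward closed [c'] lies above everything common to both. *)
Lemma tree_path_split c c' : tree_path c -> tree_path c' ->
  c `<=` c' \/ exists2 w, c w & c `&` c' `<=` initial_segment w.
Proof.
move=> [cc _] [_ c'd].
have [?|/existsNP[w /not_implyP[cw nc'w]]] := pselect (c `<=` c'); first by left.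
right; exists w => // y [cy c'y].
have /orP[wy|yw] := cc w y cw cy; first by case: nc'w; apply: c'd wy.
by rewrite /initial_segment /= lt_neqAle yw andbT; apply/eqP => yw'; apply: nc'w;
  rewrite -yw'.
Qed.

(** Take a shortest path [c] meeting [S] in an infinite set: the initial segment of a minimal node
    if one qualifies, any path otherwise. Another path contains [c] or meets it below some [w] in
    [c], where [S] is finite. If no such [c] exists, [S] itself works. *)
Lemma tree_thin (S : set T) : infinite_set S -> exists S',
  [/\ S' `<=` S, infinite_set S' & forall c, tree_path c -> nosplit S' c].
Proof.
move=> Sinf.
have core c : tree_path c -> infinite_set (S `&` c) ->
    (forall w, c w -> finite_set (S `&` initial_segment w)) -> exists S',
    [/\ S' `<=` S, infinite_set S' & forall c, tree_path c -> nosplit S' c].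
  move=> pc cinf cfin; exists (S `&` c); split=> //.
  move=> c' pc'; have [cc'|[w cw cc'w]] := tree_path_split pc pc'.
    right; suff -> : (S `&` c) `\` c' = set0 by [].
    by apply/seteqP; split=> // x [[_ /cc']].
  by left; apply: sub_finite_set (cfin w cw) => x [[Sx cx] c'x]; split=> //;
    exact: (cc'w x (conj cx c'x)).
have [H|nH] := pselect (exists x : T, infinite_set (S `&` initial_segment x)).
  have [x xinf xmin] := wf_min tree_wf H.
  apply: (core _ (tree_path_initial_segment x) xinf) => w wx.
  by apply: contrapT; apply: xmin wx.
have [[c [pc cinf]]|nc] := pselect (exists c, tree_path c /\ infinite_set (S `&` c)).
  by apply: (core c pc cinf) => w _; apply: contrapT => winf; apply: nH; exists w.
exists S; split=> // c pc; left; apply: contrapT => cinf; apply: nc; by exists c.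
Qed.

End Paths.

(** * Algebras of sets *)

Inductive gen X (G : set (set X)) : set X -> Prop :=
| gen_base A : G A -> gen G A
| gen0 : gen G set0
| genC A : gen G A -> gen G (~` A)
| genI A B : gen G A -> gen G B -> gen G (A `&` B).

Lemma genU X (G : set (set X)) A B : gen G A -> gen G B -> gen G (A `|` B).
Proof. by move=> gA gB; rewrite -[_ `|` _]setCK setCU; apply: genC; apply: genI; apply: genC. Qed.

Lemma genD X (G : set (set X)) A B : gen G A -> gen G B -> gen G (A `\` B).
Proof. by move=> gA gB; rewrite setDE; apply: genI => //; apply: genC. Qed.

Lemma genT X (G : set (set X)) : gen G setT.
Proof. by rewrite -setC0; apply/genC/gen0. Qed.

Definition set_algebra X (G : set (set X)) : Type := {A : set X | `[< gen G A >]}.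
HB.instance Definition _ X (G : set (set X)) := Choice.on (set_algebra G).

Section SetAlgebra.
Variables (X : Type) (G : set (set X)).
Local Notation B := (set_algebra G).
Implicit Types a b c : B.

Definition SA A (gA : gen G A) : B := exist _ A (asboolT gA).

Lemma SA_gen a : gen G (val a).
Proof. exact: asboolW (valP a). Qed.

Definition sa_le a b := `[< val a `<=` val b >].
Definition sa_meet a b := SA (genI (SA_gen a) (SA_gen b)).
Definition sa_join a b := SA (genU (SA_gen a) (SA_gen b)).
Definition sa_compl a := SA (genC (SA_gen a)).

Fact sa_le_def a b : sa_le a b = (sa_meet a b == a).
Proof.
apply/asboolP/eqP => [ab|<-]; last by apply: subIsetr.
by apply: val_inj; apply/setIidPl.
Qed.

Fact sa_meetC : commutative sa_meet.
Proof. by move=> a b; apply/val_inj/setIC. Qed.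
Fact sa_joinC : commutative sa_join.
Proof. by move=> a b; apply/val_inj/setUC. Qed.
Fact sa_meetA : associative sa_meet.
Proof. by move=> a b c; apply/val_inj/setIA. Qed.
Fact sa_joinA : associative sa_join.
Proof. by move=> a b c; apply/val_inj/setUA. Qed.
Fact sa_joinKI b a : sa_meet a (sa_join a b) = a.
Proof. by apply: val_inj; rewrite /= setUC setKU. Qed.
Fact sa_meetKU b a : sa_join a (sa_meet a b) = a.
Proof. by apply: val_inj; rewrite /= setIC setKI. Qed.
Fact sa_meetUl : left_distributive sa_meet sa_join.
Proof. by move=> a b c; apply/val_inj/setIUl. Qed.
Fact sa_meetxx : idempotent_op sa_meet.
Proof. by move=> a; apply/val_inj/setIid. Qed.

HB.instance Definition _ := Order.isMeetJoinDistrLattice.Build set_display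
  (set_algebra G) sa_le_def (fun _ _ => erefl) sa_meetC sa_joinC sa_meetA sa_joinA
  sa_joinKI sa_meetKU sa_meetUl sa_meetxx.

Fact sa_le0 a : (SA (gen0 G) <= a)%O.
Proof. by apply/asboolP. Qed.
Fact sa_leT a : (a <= SA (genT G))%O.
Proof. by apply/asboolP. Qed.

HB.instance Definition _ := Order.hasBottom.Build set_display (set_algebra G) sa_le0.
HB.instance Definition _ := Order.hasTop.Build set_display (set_algebra G) sa_leT.

Fact sa_joinxC a : (a `|` sa_compl a)%O = \top%O.
Proof. by apply/val_inj/setUv. Qed.
Fact sa_meetxC a : (a `&` sa_compl a)%O = \bot%O.
Proof. by apply/val_inj/setICr. Qed.

HB.instance Definition _ := Order.TBDistrLattice_hasComplement.Build set_display
  (set_algebra G) sa_joinxC sa_meetxC.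

End SetAlgebra.

(** * Superatomicity *)

(** The ideal of sets covered by finitely many [b j] with [lt j i]. *)
Inductive small X I (lt : I -> I -> Prop) (b : I -> set X) (i : I) : set X -> Prop :=
| small0 : small lt b i set0
| smallS A A' j : small lt b i A -> lt j i -> A' `<=` A `|` b j -> small lt b i A'.

Section Small.
Variables (X I : Type) (lt : I -> I -> Prop) (b : I -> set X).

Lemma small_sub i A A' : A' `<=` A -> small lt b i A -> small lt b i A'.
Proof.
move=> AA sA; elim: sA A' AA => [A'|A1 A2 j sA1 _ ji A21 A' AA].
  by rewrite subset0 => ->; apply: small0.
exact: smallS sA1 ji (subset_trans AA A21).
Qed.

Lemma small_one i j A : lt j i -> A `<=` b j -> small lt b i A.
Proof. by move=> ji Ab; apply: smallS (small0 _ _ _) ji _; rewrite set0U. Qed.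

Lemma smallU i A A' : small lt b i A -> small lt b i A' -> small lt b i (A `|` A').
Proof.
move=> sA sA'; elim: sA' => [|A1 A2 j _ IH ji A21]; first by rewrite setU0.
by apply: smallS IH ji _; rewrite -setUA; apply: setUS.
Qed.

Lemma small_finite i (F : set X) (s : X -> I) : (forall x, b (s x) = [set x]) ->
  (forall x, lt (s x) i) -> finite_set F -> small lt b i F.
Proof.
move=> sE si /(@finite_seqP {classic X})[r ->]; elim: r => [|x r IH].
  by rewrite set_nil; apply: small0.
apply: smallS IH (si x) _ => y /=; rewrite inE => /orP[/eqP ->|yr]; last by left.
by right; rewrite sE.
Qed.

Definition splits_small i A := small lt b i (b i `&` A) \/ small lt b i (b i `\` A).

(** The sets splitting [b i] trivially modulo this ideal form an algebra. *)
Lemma gen_splits_small (G : set (set X)) i :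
  (forall A, G A -> splits_small i A) -> forall A, gen G A -> splits_small i A.
Proof.
move=> H A; elim=> {A} [A /H //||A _ [sA|sA]|A A' _ [sA|sA] _ [sA'|sA']].
- by left; rewrite setI0; apply: small0.
- by right; rewrite setDE setCK.
- by left; rewrite -setDE.
- by left; apply: small_sub sA => x [? []].
- by left; apply: small_sub sA => x [? []].
- by left; apply: small_sub sA' => x [? []].
- by right; rewrite setDIr; apply: smallU.
Qed.

End Small.

(** For a nonzero [f b0], take a minimal [i] such that [b0] and [b i] have a meet with nonzero
    image; [top] ensures that one exists. Sets small at [i] vanish on [b0] in the image, so every
    element cuts [b i] trivially there and the image of the meet is an atom. *)
Lemma superatomic_set_algebra X (G : set (set X)) I (lt : I -> I -> Prop)
    (b : I -> set_algebra G) (top : I) : well_founded lt ->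
  val (b top) = setT ->
  (forall i A, G A -> splits_small lt (val \o b) i A) ->
  superatomic (set_algebra G : ctbDistrLatticeType _).
Proof.
move=> wf btop spl dC C f [fI fU fC f0 f1] fsurj c cN0.
have [b0 fb0] := fsurj c.
pose alive i := f (b0 `&` b i)%O <> \bot%O.
have [|i ilive imin] := @wf_min _ _ alive wf.
  exists top; rewrite /alive.
  have -> : (b0 `&` b top)%O = b0 by apply: val_inj; rewrite /= btop setIT.
  by rewrite fb0; apply/eqP.
have dead A (a : set_algebra G) : small lt (val \o b) i A -> val a `<=` A ->
    f (b0 `&` a)%O = \bot%O.
  move=> sA; elim: sA a => [a|A1 A2 j _ IH ji A21 a aA].
    rewrite subset0 => a0; have -> : (b0 `&` a)%O = \bot%O.
      by apply: val_inj; rewrite /= a0 setI0.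
    exact: f0.
  have -> : (b0 `&` a = (b0 `&` (a `&` ~` b j)) `|` (a `&` (b0 `&` b j)))%O.
    apply: val_inj; apply/seteqP; split=> x /=.
      move=> [b0x ax]; have [bjx|bjx] := pselect ((val (b j)) x); first by right.
      by left.
    by move=> [[? []]|[? []]].
  rewrite fU IH; last by move=> x [/aA/A21[]].
  rewrite fI; have := imin _ ji; rewrite /alive => /contrapT ->.
  by rewrite meetx0 joinx0.
exists (f (b0 `&` b i)%O); last by rewrite -fb0 fI leIl.
split; first exact/eqP.
move=> y; have [b' <-] := fsurj y => yle.
have fE : f b' = f (b0 `&` (b i `&` b'))%O.
  by rewrite meetA fI; apply/esym/meet_idPr.
have [sA|sA] := gen_splits_small (spl i) (SA_gen b').
  by left; rewrite fE; apply: dead sA _.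
right; have -> : (b0 `&` b i = (b0 `&` (b i `&` b')) `|` (b0 `&` (b i `&` ~` b')))%O.
  by rewrite -!meetUr joinxC meetx1.
by rewrite fU -fE (dead _ (b i `&` ~` b')%O sA) ?joinx0.
Qed.

(** Each element is the value of a finite term over [G], and terms are encoded as sequences over
    [nat + G]. *)
Lemma set_algebra_le X (G : set (set X)) U : infinite_set [set: U] ->
  G #<= [set: U] -> [set: set_algebra G] #<= [set: U].
Proof.
move=> Uinf GU.
pose ev := fix ev (t : GenTree.tree G) : set X := match t with
  | GenTree.Leaf g => val g
  | GenTree.Node 0 [:: t1] => ~` ev t1
  | GenTree.Node 1 [:: t1; t2] => ev t1 `&` ev t2
  | _ => set0 end.
have evP A : gen G A -> exists t, ev t = A.
  elim=> {A} [A GA||A _ [t <-]|A B _ [t <-] _ [u <-]].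
  - by exists (GenTree.Leaf (exist _ A (mem_set GA))).
  - by exists (GenTree.Node 0 [::]).
  - by exists (GenTree.Node 0 [:: t]).
  - by exists (GenTree.Node 1 [:: t; u]).
have /choice[t tP] (a : set_algebra G) : exists t, ev t = val a.
  exact: evP (SA_gen a).
apply: (@card_le_trans _ _ _ [set: seq (nat + G)]).
  apply: (@card_leT_inj _ _ (@GenTree.encode _ \o t)) => a a' /=.
  move=> /(pcan_inj (@GenTree.codeK _)) taa'.
  by apply: val_inj; rewrite -!tP taa'.
apply: (infinite_seq_le Uinf); apply: (infinite_sum_le Uinf).
  exact: infinite_nat_le.
by rewrite (card_le_eql (card_setT _)).
Qed.

(** * Atoms and automorphisms of an algebra containing all singletons *)

Section Points.
Variables (X : choiceType) (G : set (set X)).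
Hypothesis G1 : forall x, G [set x].
Local Notation B := (set_algebra G).

Definition pt x : B := SA (gen_base (G1 x)).

Lemma pt_inj : injective pt.
Proof.
by move=> x y /(congr1 val) /= xy; have : [set x] x by []; rewrite xy.
Qed.

Lemma pt_le x (a : B) : (pt x <= a)%O = `[< val a x >].
Proof.
apply/asboolP/asboolP => [/(_ x)|ax y /= ->] //; exact.
Qed.

Lemma sa_neq0 (a : B) : a != \bot%O -> exists x, val a x.
Proof.
move=> a0; apply: contrapT => nx; move/eqP: a0; apply; apply: val_inj.
by apply/seteqP; split=> x //= ax; apply: nx; exists x.
Qed.

Lemma pt_neq0 x : pt x != \bot%O.
Proof.
apply/eqP => /(congr1 val) /= x0.
by have : [set x] x by []; rewrite x0.
Qed.

Lemma atoms_set_algebra : atoms (B : ctbDistrLatticeType _) = range pt.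
Proof.
apply/seteqP; split=> [a [a0 amin]|_ [x _ <-]].
  have [x ax] := sa_neq0 a0; exists x => //.
  have [|x0|//] := amin (pt x); first by rewrite pt_le; apply/asboolP.
  by have := pt_neq0 x; rewrite x0 eqxx.
split=> [|b bx]; first exact: pt_neq0.
have [->|/sa_neq0[y by_]] := eqVneq b \bot%O; first by left.
right; apply/eqP; rewrite eq_le bx /=.
have yx : y = x by move/asboolP: bx => /(_ y by_).
by rewrite pt_le -yx; apply/asboolP.
Qed.

(** An automorphism permutes the atoms, which are the singletons, and an element is determined by
    the atoms below it. *)
Lemma automorphism_perm (f : B -> B) :
  automorphisms (B : ctbDistrLatticeType _) f -> exists g : X -> X,
    [/\ injective g, forall y, exists x, g x = y & forall a, val (f a) = g @` val a].
Proof.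
move=> [[fI fU fC f0 f1] [f' fK f'K]].
have fle a b : (f a <= f b)%O = (a <= b)%O.
  rewrite !leEmeet -fI; exact: (inj_eq (can_inj fK)).
have /choice[g gP] x : exists y, f (pt x) = pt y.
  have : atoms (B : ctbDistrLatticeType _) (f (pt x)).
    split; first by rewrite -f0 (inj_eq (can_inj fK)); apply: pt_neq0.
    have : atoms (B : ctbDistrLatticeType _) (pt x).
      by rewrite atoms_set_algebra; exists x.
    move=> [_ amin] b; rewrite -[b]f'K fle => /amin[->|->].
      by left; rewrite f0.
    by right.
  by rewrite atoms_set_algebra => -[y _ <-]; exists y.
have gmem a x : val (f a) (g x) <-> val a x.
  by split=> [|] H; apply/asboolP; [rewrite -pt_le -fle gP pt_le|
    rewrite -pt_le -gP fle pt_le]; apply/asboolP.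
have gsurj y : exists x, g x = y.
  have [|x bx] := @sa_neq0 (f' (pt y)).
    apply/eqP => /(congr1 f); rewrite f'K f0; apply/eqP; exact: pt_neq0.
  by exists x; move/gmem: bx; rewrite f'K.
exists g; split=> //.
  by move=> x y gxy; apply: pt_inj; apply: (can_inj fK); rewrite !gP gxy.
move=> a; apply/seteqP; split=> [y ay|_ [x ax <-]]; last exact/gmem.
by have [x xy] := gsurj y; exists x => //; apply/gmem; rewrite xy.
Qed.

Definition swap (x y z : X) : X := if z == x then y else if z == y then x else z.

Lemma swapK x y : involutive (swap x y).
Proof.
move=> z; rewrite /swap; case: (eqVneq z x) => [->|zx].
  by rewrite eqxx; case: eqVneq.
case: (eqVneq z y) => [->|zy]; first by rewrite eqxx.
by rewrite (negPf zx) (negPf zy).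
Qed.

(** The preimage differs from [A] in at most two points, whose singletons are generators. *)
Lemma gen_swap x y A : gen G A -> gen G (swap x y @^-1` A).
Proof.
move=> gA; have g1 z : gen G [set z] by apply: gen_base; apply: G1.
have sx : swap x y x = y by rewrite /swap eqxx.
have sy : swap x y y = x by rewrite /swap eqxx; case: eqVneq.
have sz z : z <> x -> z <> y -> swap x y z = z.
  by rewrite /swap => /eqP/negPf-> /eqP/negPf->.
have E (A' : set X) : (A' x <-> A y) -> (A' y <-> A x) ->
    (forall z, z <> x -> z <> y -> A' z <-> A z) -> swap x y @^-1` A = A'.
  move=> Ax Ay Az; apply/seteqP.
  by split=> z /=; have [->|/eqP zx] := eqVneq z x; rewrite ?sx; try exact: (iffLR Ax);
    try exact: (iffRL Ax); have [->|/eqP zy] := eqVneq z y; rewrite ?sy;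
    try tauto; rewrite sz //; have := Az z zx zy; tauto.
have [Ax|Ax] := pselect (A x); have [Ay|Ay] := pselect (A y).
- by rewrite (E A).
- rewrite (E ((A `\` [set x]) `|` [set y])); first by apply: genU => //; apply: genD.
  + split=> //= -[[_ /(_ erefl)] //|xy]; by move: Ay; rewrite -xy.
  + by split=> // _; right.
  + by move=> z zx zy; split=> [[[]|/= zy']|Az] //; left; split.
- rewrite (E ((A `\` [set y]) `|` [set x])); first by apply: genU => //; apply: genD.
  + by split=> // _; right.
  + split=> //= -[[_ /(_ erefl)] //|xy]; by move: Ax; rewrite -xy.
  + by move=> z zx zy; split=> [[[]|/= zy']|Az] //; left; split.
- by rewrite (E A).
Qed.

Definition swap_map x y (a : B) : B := SA (gen_swap x y (SA_gen a)).

Lemma swap_automorphism x y : automorphisms (B : ctbDistrLatticeType _) (swap_map x y).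
Proof.
split; first by split=> [a b|a b|a||]; apply: val_inj.
exists (swap_map x y) => a; apply: (@val_inj _ _ B); rewrite /= -comp_preimage;
  by apply/seteqP; split=> z /=; rewrite swapK.
Qed.

(** The transpositions of a fixed [x0] with [x] are told apart by what they do to [pt x0]. *)
Lemma card_le_automorphisms : [set: X] #<= automorphisms (B : ctbDistrLatticeType _).
Proof.
have [[x0]|nX] := pselect (inhabited X); last first.
  by apply: (@card_le_inj _ _ _ _ (fun=> id)) => x; case: nX.
apply: (@card_le_inj _ _ _ _ (swap_map x0)) => [x _|x y _ _ xy].
  exact: swap_automorphism.
have := congr1 (fun f => val (f (pt x0)) x) xy; rewrite /= /swap.
have -> : (if x == x0 then x else if x == x then x0 else x) = x0.
  by rewrite eqxx; case: eqVneq.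
move=> H; have : (if x == x0 then y else if x == y then x0 else x) = x0 by rewrite -H.
by case: eqVneq => [-> ->//|xx0]; case: eqVneq => // _ xx; rewrite xx eqxx in xx0.
Qed.

End Points.

(** * The algebra of the theorem *)

Section Algebra.
Variables (dM dK dT : Order.disp_t).
Variables (M : orderType dM) (K : orderType dK) (T : porderType dT).
Hypothesis T_tree : tree T.
Variable P : set M -> set T.
Hypothesis P_path : forall i c, tree_path c -> nosplit (P i) c.
Hypothesis P_ad : forall i j, i <> j -> finite_set (P i `&` P j).

Local Notation X := (T + M)%type.
Local Notation inT := (@inl T M).

(** [Top] is added to the indices of the generators so that the unit has an index, as the minimality
    argument for superatomicity requires. *)
Inductive basic :=
| Point of X | Part of set M | Below of T | Branch of branches T K | Top.

Definition basic_set (c : basic) : set X :=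
  match c with
  | Point x => [set x]
  | Part i => inT @` P i
  | Below x => inT @` initial_segment x
  | Branch b => inT @` val b
  | Top => setT
  end.

Definition generators : set (set X) :=
  [set A | exists2 c, c <> Top & A = basic_set c].

Definition rank (c : basic) : nat :=
  match c with
  | Point _ => 0 | Part _ => 1 | Below _ => 2 | Branch _ => 3 | Top => 4
  end.

(** Two paths meet in the first one or below one of its nodes, so initial segments have to precede
    branches and to be ordered by the tree among themselves. *)
Definition basic_lt (c c' : basic) : Prop :=
  match c, c' with
  | Below x, Below y => (x < y)%O
  | _, _ => (rank c < rank c')%N
  end.

Lemma basic_lt_wf : well_founded basic_lt.
Proof.
have A0 x : Acc basic_lt (Point x) by constructor=> -[].
have A1 i : Acc basic_lt (Part i) by constructor=> -[].
have A2 x : Acc basic_lt (Below x).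
  by elim/(well_founded_ind (tree_wf T_tree)): x => x IH; constructor=> -[].
have A3 b : Acc basic_lt (Branch b) by constructor=> -[].
case=> [x|i|x|b|]; [exact: A0|exact: A1|exact: A2|exact: A3|].
by constructor=> -[x|i|x|b|] h; [exact: A0|exact: A1|exact: A2|exact: A3|].
Qed.

Lemma branch_path (b : set T) : branches T K b -> tree_path b.
Proof. by case. Qed.

Lemma gen_basic c : gen generators (basic_set c).
Proof.
have [->|cT] := pselect (c = Top); first exact: genT.
by apply: gen_base; exists c.
Qed.

Lemma generators_pt x : generators [set x].
Proof. by exists (Point x). Qed.

Local Notation small := (small basic_lt basic_set).

Lemma small_fin c F : (0 < rank c)%N -> finite_set F -> small c F.
Proof.
by move=> c0; apply: (@small_finite _ _ _ _ _ _ Point) => // x; case: c c0.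
Qed.

Lemma path_split_small (c c' : set T) i : tree_path c -> tree_path c' ->
  (forall w, c w -> basic_lt (Below w) i) ->
  small i (inT @` c `&` inT @` c') \/ small i (inT @` c `\` inT @` c').
Proof.
move=> pc pc' wi; have [cc'|[w cw cc'w]] := tree_path_split pc pc'.
  right; suff -> : inT @` c `\` inT @` c' = set0 by apply: small0.
  apply/seteqP; split=> // _ [[x cx <-]]; apply; exists x => //; exact: cc'.
left; apply: small_one (wi w cw) _ => _ [[x cx <-] [y c'y [yx]]] /=.
by exists x => //; apply: cc'w; rewrite -yx in cx *.
Qed.

Lemma nosplit_inT (S b : set T) : nosplit S b -> nosplit (inT @` S) (inT @` b).
Proof.
move=> [fin|fin]; [left|right]; apply: sub_finite_set (finite_image inT fin).
  by move=> _ [[x Sx <-] [y bY [yx]]]; exists x => //; split=> //; rewrite -yx.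
by move=> _ [[x Sx <-] nbx]; exists x => //; split=> // bx; apply: nbx; exists x.
Qed.

(** A part is cut trivially up to a finite set, and finite sets are small. A path meets points and
    parts in sets of lower rank, and other paths as in [tree_path_split]. Under [Top] every
    generator is small. *)
Lemma basic_splits_small i A : generators A -> splits_small basic_lt basic_set i A.
Proof.
move=> [c cT ->]; case: i => [x|i|x|b|].
- have [xc|xc] := pselect (basic_set c x).
    right; suff -> : basic_set (Point x) `\` basic_set c = set0 by apply: small0.
    by apply/seteqP; split=> // y [/= ->].
  left; suff -> : basic_set (Point x) `&` basic_set c = set0 by apply: small0.
  by apply/seteqP; split=> // y [/= ->].
- suff [fin|fin] : nosplit (basic_set (Part i)) (basic_set c).
    by left; apply: small_fin.
    by right; apply: small_fin.
  case: c cT => [x|j|x|b|] //= _.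
  + left; apply: sub_finite_set (finite_set1 x); exact: subIsetr.
  + have [->|/P_ad ij] := pselect (i = j); first exact: nosplit_self.
    by apply: nosplit_inT; left.
  + exact/nosplit_inT/P_path/tree_path_initial_segment.
  + apply/nosplit_inT/P_path/branch_path; exact: set_valP.
- have wx w : initial_segment x w -> basic_lt (Below w) (Below x) by [].
  have px := tree_path_initial_segment T_tree x.
  case: c cT => [y|j|y|b|] //= _.
  + by left; apply: (@small_one _ _ _ _ _ (Point y)) => //; apply: subIsetr.
  + by left; apply: (@small_one _ _ _ _ _ (Part j)) => //; apply: subIsetr.
  + exact/path_split_small/wx/tree_path_initial_segment.
  + apply: path_split_small wx => //; apply: branch_path; exact: set_valP.
- have pb : tree_path (val b) by apply: branch_path; exact: set_valP.
  have wb w : val b w -> basic_lt (Below w) (Branch b) by [].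
  case: c cT => [y|j|y|b'|] //= _.
  + by left; apply: (@small_one _ _ _ _ _ (Point y)) => //; apply: subIsetr.
  + by left; apply: (@small_one _ _ _ _ _ (Part j)) => //; apply: subIsetr.
  + exact/path_split_small/wb/tree_path_initial_segment.
  + apply: path_split_small wb => //; apply: branch_path; exact: set_valP.
- left; apply: (@small_one _ _ _ _ _ c); last exact: subIsetr.
  by case: c cT.
Qed.

Local Notation Alg := (set_algebra generators).

Lemma superatomic_generators : superatomic (Alg : ctbDistrLatticeType _).
Proof.
pose b c : Alg := SA (gen_basic c).
by apply: (superatomic_set_algebra (b := b) (top := Top) basic_lt_wf) => // i A;
  apply: basic_splits_small.
Qed.

(** Points, parts and initial segments number at most [2 ^ #|M|], so the branches dominate the
    count; conversely distinct branches are distinct elements. *)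
Lemma card_generators : infinite_set [set: set M] -> [set: T] #<= [set: set M] ->
  [set: M] #<= [set: set M] -> [set: set M] #<= branches T K ->
  [set: Alg] #= branches T K.
Proof.
move=> Minf TM MM Mb; apply/card_eqPle; split.
  rewrite -(card_le_eqr (card_setT (branches T K))).
  set U := [set: branches T K].
  have MU : [set: set M] #<= U by rewrite (card_le_eqr (card_setT _)).
  have Uinf : infinite_set U by apply: contra_not Minf; apply: card_le_finite.
  apply: (set_algebra_le Uinf).
  have XU : [set: X] #<= U.
    by apply: (infinite_sum_le Uinf); [apply: card_le_trans TM _|apply: card_le_trans MM _].
  have TU := card_le_trans TM MU.
  apply: (@card_le_trans _ _ _ [set: X + (set M + (T + branches T K))]).
    apply: (@card_le_trans _ _ _ (basic_set @` [set c | c <> Top])).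
      by apply: subset_card_le => A [c cT ->]; exists c.
    apply: card_le_trans (card_image_le _ _) _.
    apply: (@card_le_inj _ _ _ _ (fun c => match c with
      | Point x => inl x | Part i => inr (inl i) | Below x => inr (inr (inl x))
      | Branch b => inr (inr (inr b)) | Top => inr (inl set0) end)) => // c c' cT c'T.
    by case: c cT => [?|?|?|?|] //; case: c' c'T => [?|?|?|?|] // _ _ [->].
  by do 3!apply: (infinite_sum_le Uinf) => //.
have lift (b : set T) : exists a : Alg, branches T K b -> val a = inT @` b.
  have [bb|nb] := pselect (branches T K b); last by exists \bot%O.
  by exists (SA (gen_basic (Branch (exist _ b (mem_set bb))))).
have {lift}/choice[h hP] := lift.
apply: (@card_le_inj _ _ _ _ h) => // b b' bb bb' /(congr1 val).
rewrite !hP // => bE.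
have K0 (c : set T) : inT @^-1` (inT @` c) = c.
  by apply/seteqP; split=> [x [y cy [<-]]|x cx] //; exists x.
by rewrite -(K0 b) bE K0.
Qed.

End Algebra.

(** * Counting the automorphisms *)

Section Automorphisms.
Variables (dM dK dT : Order.disp_t).
Variables (M : orderType dM) (K : orderType dK) (T : porderType dT).
Hypotheses (M_card : cardinal M) (M_strong_limit : strong_limit M).
Hypotheses (M_singular : singular M) (M_cof : has_cofinality M [set: nat]).
Hypothesis T_tree : tree T.
Variables (e : T -> set M) (P : set M -> set T).
Hypothesis e_inj : injective e.
Hypothesis P_dense : forall D f, large M D ->
  (forall x y, D x -> D y -> f x = f y -> x = y) -> (forall x, D x -> ~ D (f x)) ->
  exists i H, [/\ P i `<=` D, f @` P i `<=` H, infinite_set (f @` P i),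
    infinite_set (H `\` f @` P i) &
    (forall c, tree_path c -> nosplit H c) /\ (forall j, nosplit H (P j))].

Local Notation X := (T + M)%type.
Local Notation inT := (@inl T M).
Local Notation Alg := (set_algebra (generators K P)).

(** The sets that do not split a given one form an algebra, so only generators need checking. *)
Lemma nosplit_gen (H : set T) : (forall c, tree_path c -> nosplit H c) ->
  (forall j, nosplit H (P j)) -> forall A, gen (generators K P) A ->
  nosplit (inT @` H) A.
Proof.
move=> Hc HP A; elim=> {A} [A|||A B _ + _]; last exact: nosplitI; first last.
- by move=> A _; apply: nosplitC.
- by left; rewrite setI0.
case=> -[x|j|x|b|] //= _ ->.
- by left; apply: sub_finite_set (finite_set1 x); apply: subIsetr.
- exact/nosplit_inT.
- exact/nosplit_inT/Hc/tree_path_initial_segment.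
- apply/nosplit_inT/Hc/(branch_path (K := K)); exact: set_valP.
Qed.

(* Nodes moved to nodes are separated from their images by some trace, and
   there are only [#|M|] traces. *)
Lemma few_moved (g : X -> X) (f : Alg -> Alg) : injective g ->
  (forall a, val (f a) = g @` val a) ->
  [set x | g x <> x] #<= [set: M].
Proof.
move=> gI fg.
have /choice[h hP] x : exists y, forall z, g (inl x) = inl z -> z = y.
  case: (g (inl x)) => [y|m]; first by exists y => z [].
  by exists x.
pose D := [set x | exists2 z, g (inl x) = inl z & z <> x].
have DE x : D x -> g (inl x) = inl (h x) /\ h x <> x.
  by move=> [z gz zx]; rewrite -(hP x z gz).
have DM : D #<= [set: M].
  apply: contrapT => lD.
  pose F (p : (M * set M) * (M * set M)) := D `&`
    [set x | [/\ e x `&` initial_segment p.1.1 = p.1.2,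
      e (h x) `&` initial_segment p.1.1 = p.2.2 & p.1.2 <> p.2.2]].
  have [|x Dx|p _ lF] := @large_bigcup _ _ M_singular _ _
      [set p | nodes p.1 /\ nodes p.2] D F lD.
  - apply: (@card_le_trans _ _ _ [set: nodes (M:=M) * nodes (M:=M)]).
      apply: (@card_le_trans _ _ _ (nodes (M:=M) `*` nodes (M:=M))).
        exact: subset_card_le.
      apply: (@card_le_trans _ _ _ ((fun p : nodes (M:=M) * nodes (M:=M) =>
          (val p.1, val p.2)) @` setT)); last exact: card_image_le.
      apply: subset_card_le => -[p q] [/= np nq].
      by exists (exist _ p (mem_set np), exist _ q (mem_set nq)).
    have nM : [set: nodes (M:=M)] #<= [set: M].
      by rewrite (card_le_eql (card_setT _)); apply: nodes_le.
    exact: (infinite_prod_le (M_infinite M_singular) nM nM).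
  - have [a ea] : exists a, e x `&` initial_segment a <> e (h x) `&` initial_segment a.
      apply: contrapT => na; have [_] := DE x Dx; apply; apply/esym/e_inj.
      apply: (@trace_ext _ _ M_card M_strong_limit _ _ setT) => [a|a _].
        by exists a.
      by apply: contrapT => ea; apply: na; exists a.
    exists ((a, e x `&` initial_segment a), (a, e (h x) `&` initial_segment a)) => //.
    by split; move=> y [].
  have hI x y : F p x -> F p y -> h x = h y -> x = y.
    move=> [/DE[gx _] _] [/DE[gy _] _] hxy.
    by have /gI[] : g (inl x) = g (inl y) by rewrite gx gy hxy.
  have hF x : F p x -> ~ F p (h x).
    by move=> [_ [_ e1 ne]] [_ [e2 _ _]]; apply: ne; rewrite -e1 -e2.
  have [i [H [PF hPH hPinf Hinf [Hc HP]]]] := P_dense lF hI hF.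
  pose a : Alg := SA (gen_basic P (@Part _ _ _ M K T i)).
  have faE : val (f a) = inT @` (h @` P i).
    rewrite fg /=; apply/seteqP; split.
      move=> _ [_ [x Px <-] <-]; exists (h x); first by exists x.
      by have [/DE[-> _] _] := PF x Px.
    move=> _ [_ [x Px <-] <-]; exists (inl x); first by exists x.
    by have [/DE[-> _] _] := PF x Px.
  have inf (S : set T) : infinite_set S -> infinite_set (inT @` S).
    by apply: infinite_image_inj => x y _ _ [].
  (* [f a] would cut the copy of [H] into two infinite pieces, which no element of the algebra
     does. *)
  have [] := nosplit_gen Hc HP (SA_gen (f a)); rewrite faE.
    apply: sub_infinite_set (inf _ hPinf) => _ [y hy <-].
    by split; exists y => //; apply: hPH.
  apply: sub_infinite_set (inf _ Hinf) => _ [y [Hy nhy] <-].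
  by split; [exists y|move=> [z hz [zy]]; apply: nhy; rewrite -zy].
have Minf := M_infinite M_singular.
(* The remaining moved points lie in [M] or are sent into [M] by the injective [g]. *)
apply: (@card_le_trans _ _ _ (inT @` D `|` (range inr `|` g @^-1` range inr))).
  apply: subset_card_le => -[x|m] gx; last by right; left; exists m.
  case gE: (g (inl x)) => [z|m]; last by right; right; exists m.
  by left; exists x => //; exists z => // zx; apply: gx; rewrite gE zx.
apply: (infinite_setU_le Minf); first exact: card_le_trans (card_image_le _ _) DM.
apply: (infinite_setU_le Minf); first exact: card_image_le.
apply: card_le_trans (card_image_le inr setT).
by apply: (@card_le_inj _ _ _ _ g) => // x y _ _ /gI.
Qed.

(** The permutation is recovered from its graph on the moved points, being the identity elsewhere,
    and this graph is listed along [M]. The point [x0] is always included so that the list is never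
    empty. *)
Lemma automorphisms_le : [set: T] #<= [set: set M] ->
  [set: M] #<= [set: set M] ->
  automorphisms (Alg : ctbDistrLatticeType _) #<= [set: set M].
Proof.
move=> TM MM; have Minf := M_infinite M_singular.
have Sinf := sets_infinite M_singular.
have XM : [set: X] #<= [set: set M] by apply: infinite_sum_le.
apply: (@card_le_trans _ _ _ [set: M -> X * X]); last first.
  by apply: (arrow_sets_le M_singular); apply: infinite_prod_le.
pose x0 : X := inr (M_inhabited M_singular).
have /choice[c cP] (f : Alg -> Alg) : exists c : M -> X * X,
    automorphisms (Alg : ctbDistrLatticeType _) f -> exists g,
      (forall a, val (f a) = g @` val a) /\
      range c = [set p | p.2 = g p.1 /\ (p.1 = x0 \/ g p.1 <> p.1)].
  have [fA|nf] := pselect (automorphisms (Alg : ctbDistrLatticeType _) f); last first.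
    by exists (fun=> (x0, x0)).
  have [g [gI _ fg]] := automorphism_perm (generators_pt K P) fA.
  pose D := [set x | x = x0 \/ g x <> x].
  have /(card_le_injE (M_inhabited M_singular))[r [_ rI]] : D #<= [set: M].
    apply: (@card_le_trans _ _ _ ([set x0] `|` [set x | g x <> x])).
      exact: subset_card_le.
    apply: (infinite_setU_le Minf); last exact: few_moved gI fg.
    by apply: (@card_le_inj _ _ _ _ (fun=> M_inhabited M_singular)) => // x y -> ->.
  have /choice[s sP] m : exists x, D x /\ forall y, D y -> r y = m -> y = x.
    have [[x [Dx <-]]|nx] := pselect (exists x, D x /\ r x = m).
      by exists x; split=> // y Dy /rI; apply.
    exists x0; split; first by left.
    by move=> y Dy ry; case: nx; exists y.
  exists (fun m => (s m, g (s m))) => _; exists g; split=> //.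
  apply/seteqP; split=> [_ [m _ <-]|[x y] /= [-> Dx]].
    by split=> //; case: (sP m).
  by exists (r x) => //; rewrite -(proj2 (sP (r x)) x).
apply: (@card_le_inj _ _ _ _ c) => // f f' fA f'A cc.
have [g [fg gr]] := cP f fA; have [g' [fg' gr']] := cP f' f'A.
have gg : g = g'.
  rewrite cc gr' in gr; apply/funext => x.
  have H (k k' : X -> X) : [set p | p.2 = k p.1 /\ (p.1 = x0 \/ k p.1 <> p.1)] =
      [set p | p.2 = k' p.1 /\ (p.1 = x0 \/ k' p.1 <> p.1)] -> k x <> x -> k x = k' x.
    move=> E kx; have : [set p | p.2 = k p.1 /\ (p.1 = x0 \/ k p.1 <> p.1)] (x, k x)
      by split=> //; right.
    by rewrite E => -[].
  have [gx|/(H _ _ (esym gr))//] := pselect (g x = x).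
  have [g'x|/(H _ _ gr)->//] := pselect (g' x = x); by rewrite gx g'x.
by apply/funext => a; apply: val_inj; rewrite fg fg' gg.
Qed.

End Automorphisms.

Theorem theorem2
    (dM dK dT : Order.disp_t)
    (M : orderType dM) (K : orderType dK) (T : porderType dT)
    (M_card : cardinal M) (M_strong_limit : strong_limit M)
    (M_singular : singular M) (M_cof : has_cofinality M [set: nat])
    (K_card : cardinal K) (K_le : [set: K] #<= [set: set M])
    (T_tree : tree T) (T_root : rooted T) (T_levels : has_levels T K)
    (T_le : [set: T] #<= [set: set M])
    (branches_gt : card_lt [set: set M] (branches T K)) :
  exists (d : Order.disp_t) (B : ctbDistrLatticeType d),
    [/\ superatomic B,
        [set: B] #= branches T K,
        atoms B #= [set: T + M],
        [set: T + M] #<= automorphisms B &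
        automorphisms B #<= [set: set M]].
Proof.
have [e e_inj] := card_leT_injE T_le.
(* The sets that must not split the family are all the paths of the tree, which covers branches and
   initial segments at once. *)
have [P [P_path P_ad P_dense]] := dense_family M_card M_strong_limit M_singular
  M_cof e_inj (tree_thin T_tree) T_le.
have MM : [set: M] #<= [set: set M].
  apply: (@card_leT_inj _ _ (fun m => [set m])) => m m' mm'.
  by have : [set m] m by []; rewrite mm'.
exists set_display, (set_algebra (generators K P)); split.
- exact: superatomic_generators.
- apply: card_generators => //; first exact: sets_infinite.
  by case/andP: branches_gt.
- rewrite (atoms_set_algebra (generators_pt K P)).
  by apply: inj_card_eq => x y _ _ /pt_inj.
- exact: (card_le_automorphisms (generators_pt K P)).
- exact: (automorphisms_le K M_card M_strong_limit M_singular M_cof T_tree e_inj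
    P_dense T_le MM).
Qed.
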